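(* Let $X=X_1\times X_2$ be a product of two proper Hadamard spaces with the standard product metric and let $G\subset Is(X_1)\times Is(X_2)$ be a group acting properly on $X$. Assume that $G$ contains two elements $g=(g_1,g_2)$ and $h=(h_1,h_2)$ such that, for each $i\in\{1,2\}$, $g_i$ and $h_i$ are independent rank one isometries of $X_i$, and that the action satisfies the regular growth condition, i.e. $\delta_\theta\ge 0$ for every $\theta\in[0,\pi/2]$. Let $\theta\in(0,\pi/2)$, $b\in\mathbb{R}^2$, and let $\nu$ be a $G$-invariant $(b,\theta)$-density. Then no radial limit point $\eta\in\partial X$ of $G$ is a point mass for $\nu$; that is, $\nu_x(\{\eta\})=0$ for every $x\in X$ and every radial limit point $\eta$.
   Context: A Hadamard space is a complete simply connected metric space of non-positive Alexandrov curvature (a complete CAT(0) space); it is proper if all balls of finite radius are compact. For $(X_1,d_1),(X_2,d_2)$ proper Hadamard spaces, $X=X_1\times X_2$ carries the metric $d=\sqrt{d_1^2+d_2^2}$; $Is(X_i)$ is the isometry group of $X_i$; $o=(o_1,o_2)\in X$ is a fixed base point. A group $G\subset Is(X_1)\times Is(X_2)$ acts properly on $X$ if $\{g\in G: d(x,gx)\le r\}$ is finite for all $x\in X$, $r>0$. An isometry of a Hadamard space is rank one if it acts as a translation on a geodesic axis which does not bound a flat half plane; it then fixes the two endpoints of its axis in the geometric boundary. Two rank one isometries are independent if their sets of fixed boundary endpoints are disjoint. Growth rate. For $g=(g_1,g_2)\in G$ with $go\ne o$ let $\theta(g)=\arctan\frac{d_2(o_2,g_2o_2)}{d_1(o_1,g_1o_1)}\in[0,\pi/2]$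 (with value $\pi/2$ if the denominator is $0$). For $\theta\in[0,\pi/2]$, $\epsilon>0$, integer $n\ge1$, put $A_{\epsilon,\theta}(o,n)=\{g\in G: go\neq o,\ n-1\le d(o,go)<n,\ |\theta(g)-\theta|\le\epsilon\}$, $\delta_{\epsilon,\theta}=\limsup_{n\to\infty}\frac{\log|A_{\epsilon,\theta}(o,n)|}{n}$ (with $\log 0=-\infty$), and $\delta_\theta=\liminf_{\epsilon\to0}\delta_{\epsilon,\theta}$. Boundary. $\partial X,\partial X_1,\partial X_2$ are the geometric boundaries (classes of asymptotic geodesic rays) with the cone topology. For $\theta\in(0,\pi/2)$, $\partial X_\theta=\partial X_1\times\partial X_2\times\{\theta\}\subset\partial X$, where $(\alpha_1,\alpha_2,\theta)$ is the class of $t\mapsto(\sigma_1(t\cos\theta),\sigma_2(t\sin\theta))$ with $\sigma_i$ a unit speed ray in the class $\alpha_i$. $\partial X$ is the disjoint union of $\partial_{reg}X=\partial X_1\times\partial X_2\times(0,\pi/2)$ and $\partial_{sing}X=\partial X_1\cup\partial X_2$ (classes of rays constant in the other factor). $G$ acts on $\partial X$ by homeomorphisms. $L_G\subset\partial X$ is the limit set, the set of accumulation points of the orbit $Go$ in $\partial X$. The Busemann function is $B_{\alpha_i}(x,y)=\lim_{s\to\infty}\big(d_i(x,\sigma_i(s))-d_i(y,\sigma_i(s))\big)$ for $x,y\in X_i$. Density. Let $\mathcal{M}^+(\partial X)$ be the cone of finite positive Borel measures on $\partial X$ with the weak-* topology. For $\theta\in(0,\pi/2)$ and $b=(b_1,b_2)\in\mathbb{R}^2$,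 a ($G$-invariant) $(b,\theta)$-density is a continuous map $\nu:X\to\mathcal{M}^+(\partial X)$, $x\mapsto\nu_x$, such that for every $x=(x_1,x_2)\in X$: (1) $\emptyset\neq supp(\nu_x)\subset L_G\cap\partial X_\theta$; (2) $g\nu_x=\nu_{gx}$ for all $g\in G$, where $g\nu_x(E)=\nu_x(g^{-1}E)$; (3) $\nu_x$ is absolutely continuous with respect to $\nu_o$ with $\frac{d\nu_x}{d\nu_o}(\alpha)=\exp\{b_1B_{\alpha_1}(o_1,x_1)+b_2B_{\alpha_2}(o_2,x_2)\}$ for $\alpha=(\alpha_1,\alpha_2,\theta)\in supp(\nu_o)$. Radial limit point. $\eta\in\partial X$ is a radial limit point of $G$ if there is a sequence $g_n=(g_{n,1},g_{n,2})\in G$ with $g_no\to\eta$ such that: if $\eta=(\eta_1,\eta_2,\theta')\in\partial_{reg}X$, then for each $i=1,2$ all points $g_{n,i}o_i$ lie in a bounded neighbourhood of one geodesic ray in the class $\eta_i$; if $\eta=\eta_i\in\partial X_i\subset\partial_{sing}X$, then all $g_{n,i}o_i$ (for this $i$) lie in a bounded neighbourhood of one geodesic ray in the class $\eta_i$. *)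

(* Defs.v *)
From HB Require Import structures.
From mathcomp Require Import all_boot all_order all_algebra.
From mathcomp Require Import all_classical all_reals all_analysis.
From mathcomp Require Import lra.
Import Order.TTheory GRing.Theory Num.Theory.
Import numFieldNormedType.Exports.

Set Implicit Arguments.
Unset Strict Implicit.
Unset Printing Implicit Defensive.

Local Open Scope classical_set_scope.
Local Open Scope quotient_scope.
Local Open Scope ring_scope.

(** * The l2 product of two metric spaces *)

(* An alias of the cartesian product, so that it carries the metric
   sqrt (d1 ^ 2 + d2 ^ 2) and not the sup metric of the library's product. *)
Definition l2prod (T1 T2 : Type) : Type := (T1 * T2)%type.

Section l2prod.
Context (R : realType) (T1 T2 : metricType R).

HB.instance Definition _ := Choice.on (l2prod T1 T2).

Definition l2dist (x y : l2prod T1 T2) : R :=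
  Num.sqrt (mdist x.1 y.1 ^+ 2 + mdist x.2 y.2 ^+ 2).

Let l2dist_xx x : l2dist x x = 0.
Proof. by rewrite /l2dist !mdistxx expr0n addr0 sqrtr0. Qed.

Let l2dist_pos x y : l2dist x y = 0 -> x = y.
Proof.
case: x => x1 x2; case: y => y1 y2 /eqP; rewrite /l2dist sqrtr_eq0 /= => h.
have: mdist x1 y1 ^+ 2 + mdist x2 y2 ^+ 2 == 0.
  by rewrite eq_le h addr_ge0 ?sqr_ge0.
rewrite paddr_eq0 ?sqr_ge0// !sqrf_eq0 => /andP[/eqP h1 /eqP h2].
by rewrite (mdist_positivity _ _ h1) (mdist_positivity _ _ h2).
Qed.

Let l2dist_sym x y : l2dist x y = l2dist y x.
Proof. by rewrite /l2dist (metric_sym x.1) (metric_sym x.2). Qed.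

Let l2dist_triangle y x z : l2dist x z <= l2dist x y + l2dist y z.
Proof.
rewrite /l2dist.
have := metric_triangle x.1 y.1 z.1; have := metric_triangle x.2 y.2 z.2.
have := mdist_ge0 x.1 z.1; have := mdist_ge0 x.2 z.2.
move: (mdist x.1 z.1) (mdist x.2 z.2) => p q q0 p0.
move: (mdist x.1 y.1) (mdist x.2 y.2) (mdist y.1 z.1) (mdist y.2 z.2).
move=> a b c d hq hp.
have [S0 S1] : 0 <= Num.sqrt (a ^+ 2 + b ^+ 2) /\
    Num.sqrt (a ^+ 2 + b ^+ 2) ^+ 2 = a ^+ 2 + b ^+ 2.
  by rewrite sqrtr_ge0 sqr_sqrtr// addr_ge0 ?sqr_ge0.
have [U0 U1] : 0 <= Num.sqrt (c ^+ 2 + d ^+ 2) /\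
    Num.sqrt (c ^+ 2 + d ^+ 2) ^+ 2 = c ^+ 2 + d ^+ 2.
  by rewrite sqrtr_ge0 sqr_sqrtr// addr_ge0 ?sqr_ge0.
move: (Num.sqrt (a ^+ 2 + b ^+ 2)) (Num.sqrt (c ^+ 2 + d ^+ 2)) S0 S1 U0 U1.
move=> s u s0 s1 u0 u1.
rewrite -(@ler_pXn2r _ 2) ?nnegrE ?sqrtr_ge0 ?addr_ge0//.
rewrite sqr_sqrtr ?addr_ge0 ?sqr_ge0//.
have cs : a * c + b * d <= s * u.
  apply: (le_trans (ler_norm _)).
  rewrite -(@ler_pXn2r _ 2) ?nnegrE ?mulr_ge0//.
  rewrite real_normK ?num_real// exprMn s1 u1.
  have := sqr_ge0 (a * d - b * c).
  by move=> ?; lra.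
have hp2 : p ^+ 2 <= (a + c) ^+ 2.
  by rewrite ler_pXn2r ?nnegrE// (le_trans p0).
have hq2 : q ^+ 2 <= (b + d) ^+ 2.
  by rewrite ler_pXn2r ?nnegrE// (le_trans q0).
by lra.
Qed.

HB.instance Definition _ := isMetric.Build R (l2prod T1 T2)
  l2dist_xx l2dist_pos l2dist_sym l2dist_triangle.

End l2prod.

Definition euclidean_plane (R : realType) : metricType R := l2prod R^o R^o.

(** * Proper Hadamard spaces *)

Section hadamard.
Context (R : realType) (T : metricType R).

Definition is_geodesic (c : R -> T) (l : R) (x y : T) : Prop :=
  [/\ 0 <= l, c 0 = x, c l = y &
    forall s t : R, 0 <= s <= l -> 0 <= t <= l -> mdist (c s) (c t) = `|s - t|].

Definition geodesic_space : Prop :=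
  forall x y : T, exists c l, is_geodesic c l x y.

End hadamard.

Section cat0.
Context (R : realType) (T : metricType R).
Notation E2 := (euclidean_plane R).

(* The CAT(0) inequality for geodesic triangles, [p q r] in the plane being a
   comparison triangle of [x y z].  Two distinct sides of a triangle share a
   vertex, here [x]; the inequality is trivial for two points of one side. *)
Definition cat0_space : Prop :=
  geodesic_space T /\
  forall (x y z : T) (p q r : E2) (c c' : R -> T) (e e' : R -> E2) (l l' : R),
    mdist p q = mdist x y -> mdist p r = mdist x z -> mdist q r = mdist y z ->
    is_geodesic c l x y -> is_geodesic c' l' x z ->
    is_geodesic e l p q -> is_geodesic e' l' p r ->
    forall s t : R, 0 <= s <= l -> 0 <= t <= l' ->
      mdist (c s) (c' t) <= mdist (e s) (e' t).

Definition complete_space : Prop :=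
  forall F : set_system T, ProperFilter F -> cauchy F -> exists x : T, F --> x.

Definition hadamard_space : Prop := complete_space /\ cat0_space.

Definition proper_space : Prop :=
  forall (x : T) (r : R), compact [set y | mdist x y <= r].

Definition proper_hadamard_space : Prop := hadamard_space /\ proper_space.

End cat0.

(** * The isometry group *)

Record self_isometry (R : realType) (T : metricType R) := Isometry {
  isom_fun :> T -> T ;
  isom_dist : forall x y, mdist (isom_fun x) (isom_fun y) = mdist x y ;
  isom_surj : forall y, exists x, isom_fun x = y
}.

Section isometry_group.
Context (R : realType) (T : metricType R).
Implicit Types f g h : self_isometry T.

HB.instance Definition _ := gen_eqMixin (self_isometry T).
HB.instance Definition _ := gen_choiceMixin (self_isometry T).

Lemma isom_ext f g : (forall x, f x = g x) -> f = g.
Proof.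
case: f g => f fd fs [g gd gs] /= /funext fg; case: _ / fg in gd gs *.
by congr Isometry; exact: Prop_irrelevance.
Qed.

Definition isom_one : self_isometry T :=
  @Isometry R T id (fun _ _ => erefl) (fun y => ex_intro _ y erefl).

Lemma isom_mul_surj f g y : exists x, f (g x) = y.
Proof.
by have [z <-] := isom_surj f y; have [x <-] := isom_surj g z; exists x.
Qed.

Definition isom_mul f g : self_isometry T :=
  @Isometry R T (fun x => f (g x))
    (fun x y => etrans (isom_dist f (g x) (g y)) (isom_dist g x y))
    (isom_mul_surj f g).

Definition isom_inv_fun f (y : T) : T := sval (cid (isom_surj f y)).

Lemma isom_inv_funK f y : f (isom_inv_fun f y) = y.
Proof. by rewrite /isom_inv_fun; case: cid. Qed.

Lemma isom_funK f x : isom_inv_fun f (f x) = x.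
Proof.
by apply: (@mdist_positivity R T); rewrite -(isom_dist f) isom_inv_funK mdistxx.
Qed.

Lemma isom_inv_dist f x y :
  mdist (isom_inv_fun f x) (isom_inv_fun f y) = mdist x y.
Proof. by rewrite -(isom_dist f) !isom_inv_funK. Qed.

Definition isom_inv f : self_isometry T :=
  @Isometry R T (isom_inv_fun f) (isom_inv_dist f)
    (fun x => ex_intro _ (f x) (isom_funK f x)).

Let mulA : associative isom_mul.
Proof. by move=> f g h; exact: isom_ext. Qed.
Let mul1 : left_id isom_one isom_mul.
Proof. by move=> f; exact: isom_ext. Qed.
Let mulr1 : right_id isom_one isom_mul.
Proof. by move=> f; exact: isom_ext. Qed.
Let mulV : left_inverse isom_one isom_inv isom_mul.
Proof. by move=> f; apply: isom_ext => x; exact: isom_funK. Qed.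
Let mulrV : right_inverse isom_one isom_inv isom_mul.
Proof. by move=> f; apply: isom_ext => x; exact: isom_inv_funK. Qed.

HB.instance Definition _ :=
  isGroup.Build (self_isometry T) mulA mul1 mulr1 mulV mulrV.

End isometry_group.

Section product_isometry.
Context (R : realType) (T1 T2 : metricType R).
Implicit Type g : self_isometry T1 * self_isometry T2.

Definition prod_fun g (x : l2prod T1 T2) : l2prod T1 T2 := (g.1 x.1, g.2 x.2).

Lemma prod_fun_dist g x y : mdist (prod_fun g x) (prod_fun g y) = mdist x y.
Proof. by rewrite /mdist /= /l2dist /= !isom_dist. Qed.

Lemma prod_fun_surj g y : exists x, prod_fun g x = y.
Proof.
case: y => y1 y2; have [x1 <-] := isom_surj g.1 y1.
by have [x2 <-] := isom_surj g.2 y2; exists (x1, x2).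
Qed.

Definition prod_isom g : self_isometry (l2prod T1 T2) :=
  @Isometry R (l2prod T1 T2) (prod_fun g) (prod_fun_dist g) (prod_fun_surj g).

End product_isometry.

(** * The geometric boundary *)

Section boundary.
Context (R : realType) (T : metricType R).

(* The values of a ray at negative parameters are irrelevant. *)
Definition is_ray (s : R -> T) : Prop :=
  forall t u : R, 0 <= t -> 0 <= u -> mdist (s t) (s u) = `|t - u|.

Record ray := Ray { ray_fun :> R -> T ; rayP : is_ray ray_fun }.

HB.instance Definition _ := gen_eqMixin ray.
HB.instance Definition _ := gen_choiceMixin ray.

Definition asymptotic (s t : ray) : bool :=
  `[< exists C : R, forall u : R, 0 <= u -> mdist (s u) (t u) <= C >].

Lemma asymptotic_refl : reflexive asymptotic.
Proof. by move=> s; apply/asboolP; exists 0 => u _; rewrite mdistxx. Qed.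

Lemma asymptotic_sym : symmetric asymptotic.
Proof.
move=> s t; apply/asboolP/asboolP => -[C h]; exists C => u /h.
  by rewrite metric_sym.
by rewrite metric_sym.
Qed.

Lemma asymptotic_trans : transitive asymptotic.
Proof.
move=> t s v /asboolP[C h] /asboolP[D k]; apply/asboolP; exists (C + D) => u u0.
by apply: (le_trans (metric_triangle _ (t u) _)); rewrite lerD ?h ?k.
Qed.

Canonical asymptotic_equiv :=
  EquivRel asymptotic asymptotic_refl asymptotic_sym asymptotic_trans.

Definition boundary : Type := {eq_quot asymptotic_equiv}.

HB.instance Definition _ := Choice.on boundary.

Definition ray_class (s : ray) : boundary := \pi_({eq_quot asymptotic_equiv}) s.

Definition ray_of (xi : boundary) : ray :=
  @repr ray {eq_quot asymptotic_equiv} xi.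

(** The union of T and its boundary, with the cone topology. *)

Definition bordification : Type := (T + boundary)%type.

HB.instance Definition _ := Choice.on bordification.

(* For T a Hadamard space, [cone_nbhd c r e] is the set of the points of the
   bordification lying beyond the sphere of centre c(0) and radius r whose
   projection to this sphere is e-close to c(r). *)
Definition cone_nbhd (c : ray) (r e : R) : set bordification :=
  fun p => match p with
  | inl x => r < mdist (c 0) x /\
      exists d l, is_geodesic d l (c 0) x /\ mdist (d r) (c r) < e
  | inr xi => exists d : ray,
      [/\ ray_class d = xi, d 0 = c 0 & mdist (d r) (c r) < e]
  end.

Definition cone_subbase : set (set bordification) :=
  [set U | (exists x r, U = inl @` ball x r) \/
           (exists c r e, [/\ 0 < r, 0 < e & U = cone_nbhd c r e])].

HB.instance Definition _ :=
  @isSubBaseTopological.Build bordification (set bordification) cone_subbase id.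

HB.instance Definition _ := Topological.copy boundary
  (initial_topology (@inr T boundary : boundary -> bordification)).

(** The action of isometries *)

Lemma isom_ray_subproof (g : self_isometry T) (s : ray) : is_ray (g \o s).
Proof. by move=> t u t0 u0; rewrite /= isom_dist rayP. Qed.

Definition isom_ray (g : self_isometry T) (s : ray) : ray :=
  Ray (isom_ray_subproof g s).

Definition boundary_act (g : self_isometry T) (xi : boundary) : boundary :=
  ray_class (isom_ray g (ray_of xi)).

(* B_xi (x, y); on a Hadamard space the limit exists and does not depend on the
   ray chosen in the class. *)
Definition busemann (xi : boundary) (x y : T) : R :=
  lim (mdist x (ray_of xi s) - mdist y (ray_of xi s) @[s --> +oo]).

(** Rank one isometries *)

Definition is_line (c : R -> T) : Prop :=
  forall s t, mdist (c s) (c t) = `|s - t|.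

Definition bounds_flat_half_plane (c : R -> T) : Prop :=
  exists F : euclidean_plane R -> T,
    (forall p q : euclidean_plane R, 0 <= p.2 -> 0 <= q.2 ->
       mdist (F p) (F q) = mdist p q) /\
    (forall t, F (t, 0) = c t).

Definition rank_one_axis (g : self_isometry T) (c : R -> T) : Prop :=
  [/\ is_line c,
      exists2 l : R, 0 < l & forall t, g (c t) = c (t + l) &
      ~ bounds_flat_half_plane c].

Definition rank_one (g : self_isometry T) : Prop := exists c, rank_one_axis g c.

Definition line_ends (c : R -> T) : set boundary :=
  [set xi | exists s : ray, ray_class s = xi /\
    ((forall t : R, 0 <= t -> s t = c t) \/
     (forall t : R, 0 <= t -> s t = c (- t)))].

Definition fixed_ends (g : self_isometry T) : set boundary :=
  [set xi | exists2 c, rank_one_axis g c & line_ends c xi].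

Definition independent_rank_one (g h : self_isometry T) : Prop :=
  [/\ rank_one g, rank_one h & fixed_ends g `&` fixed_ends h = set0].

(** Finite Borel measures on the boundary *)

(* The measurable types of the library are pointed, whence the parameter [xi0].
   It plays no other role: there is no (b, theta)-density, and no limit point,
   when the boundary is empty. *)
Definition pboundary (xi0 : boundary) : Type := boundary.

HB.instance Definition _ (xi0 : boundary) := Topological.on (pboundary xi0).
HB.instance Definition _ (xi0 : boundary) :=
  isPointed.Build (pboundary xi0) xi0.

Definition borel_boundary (xi0 : boundary) :=
  g_sigma_algebraType (@open (pboundary xi0)).

Definition finite_measures (xi0 : boundary) : Type :=
  {finite_measure set (borel_boundary xi0) -> \bar R}.

HB.instance Definition _ (xi0 : boundary) := gen_eqMixin (finite_measures xi0).
HB.instance Definition _ (xi0 : boundary) :=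
  gen_choiceMixin (finite_measures xi0).

Definition weak_star_eval (xi0 : boundary) (mu : finite_measures xi0) :
    {ptws continuousType boundary R -> R} :=
  fun f => (\int[mu]_(xi in [set: borel_boundary xi0]) (f xi))%R.

(* The weak-* topology. *)
HB.instance Definition _ (xi0 : boundary) :=
  Topological.copy (finite_measures xi0)
    (initial_topology (@weak_star_eval xi0)).

Definition supp (xi0 : boundary) (mu : finite_measures xi0) : set boundary :=
  [set xi | forall U : set boundary, open U -> U xi -> (0 < mu U)%E].

End boundary.

(** * Groups acting on a product *)

Section product_action.
Context (R : realType) (X1 X2 : metricType R).
Notation X := (l2prod X1 X2).
Implicit Types (G : set (self_isometry X1 * self_isometry X2)) (o : X).

Definition acts_properly G : Prop :=
  forall (x : X) (r : R), 0 < r ->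
    finite_set [set g | G g /\ mdist x (prod_isom g x) <= r].

(** The exponential growth rate of slope theta *)

(* Since x / 0 = 0 in the library, the vertical direction is singled out. *)
Definition slope o (g : self_isometry X1 * self_isometry X2) : R :=
  if mdist o.1 (g.1 o.1) == 0 then pi / 2
  else atan (mdist o.2 (g.2 o.2) / mdist o.1 (g.1 o.1)).

Definition slope_annulus G o (eps theta : R) (n : nat) :
    set (self_isometry X1 * self_isometry X2) :=
  [set g | [/\ G g, prod_isom g o <> o,
      n%:R - 1 <= mdist o (prod_isom g o) < n%:R &
      `|slope o g - theta| <= eps]].

(* [lne 0 = -oo]; the value at n = 0 has no influence on the limsup. *)
Definition growth_eps G o (eps theta : R) : \bar R :=
  limn_esup (fun n : nat =>
    (lne (counting (slope_annulus G o eps theta n)) * (n%:R^-1)%:E)%E).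

Definition growth G o (theta : R) : \bar R :=
  limf_einf (fun eps : R => growth_eps G o eps theta) (0 : R)^'+.

Definition regular_growth G o : Prop :=
  forall theta : R, 0 <= theta <= pi / 2 -> (0 <= growth G o theta)%E.

(** The regular and the singular boundary *)

(* [regular_point theta xi1 xi2 eta] means eta = (xi1, xi2, theta), for theta
   in the open interval (0, pi / 2). *)
Definition regular_point (theta : R) (xi1 : boundary X1) (xi2 : boundary X2)
    (eta : boundary X) : Prop :=
  exists (s1 : ray X1) (s2 : ray X2) (s : ray X),
    [/\ ray_class s1 = xi1, ray_class s2 = xi2, ray_class s = eta &
      forall t : R, 0 <= t -> s t = (s1 (t * cos theta), s2 (t * sin theta))].

Definition singular_point1 (xi1 : boundary X1) (eta : boundary X) : Prop :=
  exists (s1 : ray X1) (x2 : X2) (s : ray X),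
    [/\ ray_class s1 = xi1, ray_class s = eta &
      forall t : R, 0 <= t -> s t = (s1 t, x2)].

Definition singular_point2 (xi2 : boundary X2) (eta : boundary X) : Prop :=
  exists (s2 : ray X2) (x1 : X1) (s : ray X),
    [/\ ray_class s2 = xi2, ray_class s = eta &
      forall t : R, 0 <= t -> s t = (x1, s2 t)].

Definition boundary_slope (theta : R) : set (boundary X) :=
  [set eta | exists xi1 xi2, regular_point theta xi1 xi2 eta].

Definition limit_set G o : set (boundary X) :=
  [set eta | limit_point
    [set (inl (prod_isom g o) : bordification X) | g in G]
    (inr eta : bordification X)].

(** (b, theta)-densities *)

Local Open Scope charge_scope.

(* A Radon-Nikodym derivative is only defined almost everywhere, so that its
   values on the support of [nu o] are prescribed almost everywhere. *)
Definition is_density G o (b : R * R) (theta : R) (xi0 : boundary X)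
    (nu : X -> finite_measures xi0) : Prop :=
  continuous nu /\
  forall x : X,
  [/\ supp (nu x) !=set0,
      supp (nu x) `<=` limit_set G o `&` boundary_slope theta,
      forall g, G g -> forall E : set (borel_boundary xi0), measurable E ->
        nu x (boundary_act (prod_isom g) @^-1` E) = nu (prod_isom g x) E,
      nu x `<< nu o &
      {ae nu o, forall eta, supp (nu o) eta ->
        forall xi1 xi2, regular_point theta xi1 xi2 eta ->
        ('d (charge_of_finite_measure (nu x)) '/d (nu o)) eta =
        (expR (b.1 * busemann xi1 o.1 x.1 + b.2 * busemann xi2 o.2 x.2))%:E}].

(** Radial limit points *)

Definition close_to_ray (T : metricType R) (u : nat -> T) (xi : boundary T) :
    Prop :=
  exists (s : ray T) (C : R), ray_class s = xi /\
    forall n, exists2 t : R, 0 <= t & mdist (u n) (s t) <= C.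

Definition radial_limit_point G o (eta : boundary X) : Prop :=
  exists g : nat -> self_isometry X1 * self_isometry X2,
  [/\ forall n, G (g n),
      (inl (prod_isom (g n) o) : bordification X) @[n --> \oo] -->
        (inr eta : bordification X) &
      [\/ exists (theta : R) xi1 xi2, [/\ 0 < theta < pi / 2,
            regular_point theta xi1 xi2 eta,
            close_to_ray (fun n => (g n).1 o.1) xi1 &
            close_to_ray (fun n => (g n).2 o.2) xi2],
          exists2 xi1, singular_point1 xi1 eta &
            close_to_ray (fun n => (g n).1 o.1) xi1 |
          exists2 xi2, singular_point2 xi2 eta &
            close_to_ray (fun n => (g n).2 o.2) xi2]].

End product_action.

(* Main.v *)
Require Import Defs.
From mathcomp Require Import all_boot all_order all_algebra finmap.
From mathcomp Require Import all_classical all_reals all_analysis.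
From mathcomp Require Import ring lra.
Import Order.TTheory GRing.Theory Num.Theory.
Import numFieldNormedType.Exports.

(** Suppose that eta = (xi1, xi2, theta) has positive mass m for nu o, and write
    f g = b1 * B_xi1 (o1, g1 o1) + b2 * B_xi2 (o2, g2 o2).  By invariance and
    the formula for the Radon-Nikodym derivative, the point g^-1 eta has mass
    m * exp (f g), which is at most the total mass of nu o.  So f is bounded
    above on G, and this alone determines b.

    The growth condition at the two extreme slopes 0 and pi / 2 provides
    elements g_n of G that go to infinity while d2 = o(d1), respectively
    d1 = o(d2).  If b1 were negative, boundedness of f at all k g_n, with k a
    power of one of the two given elements, would make the Busemann function at
    xi1 grow at most sublinearly on all the sequences k1 g_n,1 o1.  By
    convexity, a limit ray of the geodesics from o1 to g_n,1 o1 would then stay,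
    like all its translates by the k1, in horoballs centred at xi1.  For a rank one isometry,
    only rays that point to an end of the axis can do so (horoball_rays), and
    two independent isometries have no common end.  So b1 >= 0, and b2 >= 0 by
    symmetry (factor_weight_ge0).

    Along a radial sequence towards eta both Busemann functions tend to
    infinity, since theta is neither 0 nor pi / 2 (close_busemann and
    regular_cvg_diverges).  As f stays bounded, b1 = b2 = 0.  Now all points of
    the orbit of eta have the same mass m, so that the orbit is finite, and a
    power of each of the two given elements fixes xi1 (massive_point_fixed).
    But a boundary point fixed by a rank one isometry is an end of its axis
    (fixed_is_end), so that independence is contradicted again.

    The rank one condition enters through one fact (end_slope): along the axis
    of a rank one isometry, every Busemann function has slope 1 or -1 at either
    end.  Otherwise the translates of a ray would accumulate on a ray whose
    Busemann function is affine along the axis, with a slope strictly between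
    -1 and 1, and the rays towards this limit point that start on the axis
    would fill a flat half plane (flat_half_plane).

    Non-positive curvature is used only in the form of the inequality cn_ineq
    of Bruhat and Tits, which holds in the product as well. *)

Set Implicit Arguments.
Unset Strict Implicit.
Unset Printing Implicit Defensive.
Local Open Scope classical_set_scope.
Local Open Scope ring_scope.

(** * Euclidean comparison *)

Section real_facts.
Context (R : realType).
Implicit Types a b c e x y z : R.

Lemma ler_of_sqr a b : 0 <= b -> a ^+ 2 <= b ^+ 2 -> a <= b.
Proof.
by move=> b0 h; rewrite leNgt; apply/negP => ba; have := ltW ba; nra.
Qed.

Lemma eqr_of_sqr a b : 0 <= a -> 0 <= b -> a ^+ 2 = b ^+ 2 -> a = b.
Proof. by move=> a0 b0 /eqP; rewrite eqrXn2// => /eqP. Qed.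

(** The third vertex (u, v) of a Euclidean triangle with sides a, b, c, whose
    side a lies on the first axis: u is given by the law of cosines, and the
    triangle inequalities say that b ^+ 2 - u ^+ 2 is nonnegative. *)
Lemma comparison_vertex a b c : 0 < a -> 0 <= b -> 0 <= c ->
  a <= b + c -> b <= a + c -> c <= a + b ->
  exists u v, u ^+ 2 + v ^+ 2 = b ^+ 2 /\ (u - a) ^+ 2 + v ^+ 2 = c ^+ 2.
Proof.
move=> a0 b0 c0 h1 h2 h3.
pose u := (a ^+ 2 + b ^+ 2 - c ^+ 2) / (2 * a).
have ua : 2 * a * u = a ^+ 2 + b ^+ 2 - c ^+ 2 by rewrite /u; field; lra.
have v0 : 0 <= b ^+ 2 - u ^+ 2.
  have : 0 <= (2 * a * b - 2 * a * u) * (2 * a * b + 2 * a * u).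
    by rewrite ua; apply: mulr_ge0; nra.
  have -> : (2 * a * b - 2 * a * u) * (2 * a * b + 2 * a * u) =
            4 * a ^+ 2 * (b ^+ 2 - u ^+ 2) by ring.
  by rewrite pmulr_rge0// mulr_gt0// exprn_gt0.
exists u, (Num.sqrt (b ^+ 2 - u ^+ 2)); rewrite sqr_sqrtr//.
by split; [ring|nra].
Qed.

End real_facts.

Lemma l2dist_sqr (R : realType) (T1 T2 : metricType R) (x y : l2prod T1 T2) :
  mdist x y ^+ 2 = mdist x.1 y.1 ^+ 2 + mdist x.2 y.2 ^+ 2.
Proof. by rewrite {1}/mdist /= /l2dist sqr_sqrtr// addr_ge0 ?sqr_ge0. Qed.

Lemma plane_dist_sqr (R : realType) (u v u' v' : R) :
  mdist ((u, v) : euclidean_plane R) (u', v') ^+ 2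
  = (u - u') ^+ 2 + (v - v') ^+ 2.
Proof.
rewrite l2dist_sqr /=; congr (_ + _); rewrite /mdist /= ?real_normK ?num_real//.
  by ring.
by ring.
Qed.

Lemma plane_segment (R : realType) (u v l : R) :
  0 < l -> u ^+ 2 + v ^+ 2 = l ^+ 2 ->
  is_geodesic (fun t => (t / l * u, t / l * v) : euclidean_plane R) l
    (0, 0) (u, v).
Proof.
move=> l0 uv; split; rewrite ?mul0r ?divff ?mul1r ?gt_eqF ?(ltW l0)//.
move=> s t _ _; apply: eqr_of_sqr; rewrite ?mdist_ge0//.
rewrite plane_dist_sqr real_normK ?num_real//.
have -> : (s / l * u - t / l * u) ^+ 2 + (s / l * v - t / l * v) ^+ 2 =
  ((s - t) / l) ^+ 2 * (u ^+ 2 + v ^+ 2) by ring.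
by rewrite uv; field; rewrite gt_eqF.
Qed.

Section cn.
Context (R : realType) (T : metricType R).
Implicit Types (x y z p : T) (l t : R).

(** The inequality of Bruhat and Tits at a point of arbitrary ratio.  It
   mentions points only, so that it passes to products. *)
Definition cn_ineq := forall x y z p l, 0 <= l <= 1 ->
  mdist x z = l * mdist x y -> mdist z y = (1 - l) * mdist x y ->
  mdist p z ^+ 2 <= (1 - l) * mdist p x ^+ 2 + l * mdist p y ^+ 2
                    - l * (1 - l) * mdist x y ^+ 2.

Lemma geodesic_length (c : R -> T) l x y : is_geodesic c l x y -> mdist x y = l.
Proof.
case=> l0 <- <- h; rewrite h ?lexx ?l0// sub0r normrN ger0_norm//.
Qed.

Lemma cat0_cn_geodesic x y p (c : R -> T) l t : cat0_space T ->
  is_geodesic c l x y -> 0 < l -> 0 <= t <= l ->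
  mdist p (c t) ^+ 2 <= (1 - t / l) * mdist p x ^+ 2
    + t / l * mdist p y ^+ 2 - t / l * (1 - t / l) * l ^+ 2.
Proof.
move=> [geo comp] hc l0 tl; have xy := geodesic_length hc.
have [xp|xp] := eqVneq x p.
  case: hc => _ hx _ hd.
  rewrite -xp mdistxx xy -{1}hx hd ?lexx ?(ltW l0)// sub0r normrN.
  by rewrite real_normK ?num_real// le_eqVlt; apply/orP; left; apply/eqP;
    field; rewrite gt_eqF.
have [c' [l' hc']] := geo x p; have xp' := geodesic_length hc'.
have l'0 : 0 < l' by rewrite -xp' mdist_gt0.
have [] := @comparison_vertex R l l' (mdist y p) l0 (ltW l'0) (mdist_ge0 _ _).
- by rewrite -xy -xp' (metric_sym y) metric_triangle.
- by rewrite -xy -xp' metric_triangle.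
- by rewrite -xy -xp' (metric_sym x y) metric_triangle.
move=> u [v [uv uv']].
pose P : euclidean_plane R := (0, 0); pose Q : euclidean_plane R := (l, 0).
pose W : euclidean_plane R := (u, v).
have ll : l ^+ 2 + 0 ^+ 2 = l ^+ 2 by rewrite expr0n addr0.
have := comp x y p P Q W c c' _ _ l l' _ _ _ hc hc' (plane_segment l0 ll)
  (plane_segment l'0 uv) t l'.
have -> : c' l' = p by case: hc'.
move=> /(_ _ _ _ tl) h.
have {}h : mdist (c t) p <= mdist ((t / l * l, t / l * 0) : euclidean_plane R)
    (l' / l' * u, l' / l' * v).
  apply: h; rewrite ?lexx ?(ltW l'0)//; apply: eqr_of_sqr;
    rewrite ?mdist_ge0// plane_dist_sqr ?xy ?xp'//; [by ring|by rewrite -uv; ring|].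
  by rewrite -uv'; ring.
rewrite divff ?gt_eqF// !mul1r mulr0 divfK ?gt_eqF// metric_sym in h.
have := h; rewrite -(@ler_pXn2r _ 2) ?nnegrE ?mdist_ge0// plane_dist_sqr => h2.
apply: (le_trans h2); rewrite !(metric_sym p) xp' -uv -uv'.
by rewrite le_eqVlt; apply/orP; left; apply/eqP; field; rewrite gt_eqF.
Qed.

(** The point z is the one that a geodesic from x to y meets at the ratio l,
    by cat0_cn_geodesic applied at z itself: its right-hand side is then 0. *)
Lemma cat0_cn : cat0_space T -> cn_ineq.
Proof.
move=> hT x y z p l l01 xz zy.
have [geo _] := hT; have [c [D hc]] := geo x y; have xy := geodesic_length hc.
have [D0|D0] := eqVneq D 0.
  have xz0 : x = z by apply: mdist_positivity; rewrite xz xy D0 mulr0.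
  have xy0 : x = y by apply: mdist_positivity; rewrite xy D0.
  rewrite -xz0 -xy0 mdistxx.
  by rewrite le_eqVlt; apply/orP; left; apply/eqP; ring.
have {}D0 : 0 < D by rewrite lt_neqAle eq_sym D0 -xy mdist_ge0.
have tD : 0 <= l * D <= D by nra.
have key q := cat0_cn_geodesic q hT hc D0 tD.
rewrite mulfK ?gt_eqF// in key.
have zc : mdist z (c (l * D)) = 0.
  apply/eqP; rewrite -sqrf_eq0 eq_le sqr_ge0 andbT (le_trans (key z))//.
  rewrite (metric_sym z x) xz zy xy.
  by rewrite le_eqVlt; apply/orP; left; apply/eqP; ring.
by rewrite (mdist_positivity _ _ zc) xy; exact: key.
Qed.

End cn.

(** * Products, rays and Busemann functions *)

(** Equality in Minkowski's inequality: a point that divides a segment of the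
    product divides both projections of it in the same ratio. *)
Lemma l2_ratio (R : realType) (T1 T2 : metricType R) (x y z : l2prod T1 T2)
    (l : R) : 0 <= l <= 1 ->
  mdist x z = l * mdist x y -> mdist z y = (1 - l) * mdist x y ->
  (mdist x.1 z.1 = l * mdist x.1 y.1 /\
   mdist z.1 y.1 = (1 - l) * mdist x.1 y.1) /\
  (mdist x.2 z.2 = l * mdist x.2 y.2 /\
   mdist z.2 y.2 = (1 - l) * mdist x.2 y.2).
Proof.
move=> l01 xz zy.
have e1 : mdist x z ^+ 2 = l ^+ 2 * mdist x y ^+ 2 by rewrite xz exprMn.
have e2 : mdist z y ^+ 2 = (1 - l) ^+ 2 * mdist x y ^+ 2 by rewrite zy exprMn.
move: e1 e2; rewrite !l2dist_sqr.
have := metric_triangle x.1 z.1 y.1; have := metric_triangle x.2 z.2 y.2.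
have := mdist_ge0 x.1 z.1; have := mdist_ge0 x.2 z.2.
have := mdist_ge0 z.1 y.1; have := mdist_ge0 z.2 y.2.
have := mdist_ge0 x.1 y.1; have := mdist_ge0 x.2 y.2.
move: (mdist x.1 z.1) (mdist x.2 z.2) (mdist z.1 y.1) (mdist z.2 y.2).
move: (mdist x.1 y.1) (mdist x.2 y.2) => c1 c2 a1 a2 b1 b2 c20 c10 b20 b10.
move=> a20 a10 t2 t1 e1 e2.
have s1 : 0 <= (a1 + b1) ^+ 2 - c1 ^+ 2 by nra.
have s2 : 0 <= (a2 + b2) ^+ 2 - c2 ^+ 2 by nra.
have cs : (a1 * b1 + a2 * b2) <= l * (1 - l) * (c1 ^+ 2 + c2 ^+ 2).
  apply: ler_of_sqr; first by nra.
  have -> : (l * (1 - l) * (c1 ^+ 2 + c2 ^+ 2)) ^+ 2 =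
    (l ^+ 2 * (c1 ^+ 2 + c2 ^+ 2)) * ((1 - l) ^+ 2 * (c1 ^+ 2 + c2 ^+ 2)).
    by ring.
  by rewrite -e1 -e2; have := sqr_ge0 (a1 * b2 - a2 * b1); nra.
have ab : a1 * b1 + a2 * b2 = l * (1 - l) * (c1 ^+ 2 + c2 ^+ 2) by nra.
have q0 : ((1 - l) * a1 - l * b1) ^+ 2 + ((1 - l) * a2 - l * b2) ^+ 2 = 0.
  transitivity ((1 - l) ^+ 2 * (a1 ^+ 2 + a2 ^+ 2)
    + l ^+ 2 * (b1 ^+ 2 + b2 ^+ 2) - 2 * l * (1 - l) * (a1 * b1 + a2 * b2)).
    by ring.
  by rewrite e1 e2 ab; ring.
have [/eqP r1 /eqP r2] : ((1 - l) * a1 - l * b1) == 0 /\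
    ((1 - l) * a2 - l * b2) == 0.
  by move/eqP: q0; rewrite paddr_eq0 ?sqr_ge0// !sqrf_eq0 => /andP[-> ->].
have c1E : c1 = a1 + b1 by nra.
have c2E : c2 = a2 + b2 by nra.
by split; split; nra.
Qed.

Lemma cn_l2prod (R : realType) (T1 T2 : metricType R) :
  cn_ineq T1 -> cn_ineq T2 -> cn_ineq (l2prod T1 T2).
Proof.
move=> cn1 cn2 x y z p l l01 xz zy.
have [[a1 b1] [a2 b2]] := l2_ratio l01 xz zy.
have := cn1 x.1 y.1 z.1 p.1 l l01 a1 b1.
by have := cn2 x.2 y.2 z.2 p.2 l l01 a2 b2; rewrite !l2dist_sqr; lra.
Qed.

Section rays.
Context (R : realType) (T : metricType R).
Implicit Types (x y z p : T) (l t u : R) (s c : R -> T).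

Definition asymp s s' : Prop :=
  exists C : R, forall t, 0 <= t -> mdist (s t) (s' t) <= C.

Lemma asymp_sym s s' : asymp s s' -> asymp s' s.
Proof. by move=> [C h]; exists C => t /h; rewrite metric_sym. Qed.

Lemma asymp_trans s s' s'' : asymp s s' -> asymp s' s'' -> asymp s s''.
Proof.
move=> [C h] [D k]; exists (C + D) => t t0.
by apply: (le_trans (metric_triangle _ (s' t) _)); rewrite lerD ?h ?k.
Qed.

Lemma asymp_isom (g : self_isometry T) s s' :
  asymp s s' -> asymp (g \o s) (g \o s').
Proof. by move=> [C h]; exists C => t t0 /=; rewrite isom_dist h. Qed.

Lemma eq_asymp s s' : (forall t, 0 <= t -> s t = s' t) -> asymp s s'.
Proof. by move=> h; exists 0 => t t0; rewrite h// mdistxx. Qed.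

Lemma ray_dist s t u : is_ray s -> 0 <= t <= u -> mdist (s t) (s u) = u - t.
Proof.
move=> hs /andP[t0 tu]; rewrite hs ?(le_trans t0)// distrC ger0_norm//.
by rewrite subr_ge0.
Qed.

(** The horofunction of the ray s, which vanishes at s 0.  The distances minus
    t decrease with t, so that their infimum is their limit. *)
Definition buse s x := inf [set mdist x (s t) - t | t in [set t | 0 <= t]].

Lemma buse_has_inf s x : is_ray s ->
  has_inf [set mdist x (s t) - t | t in [set t | 0 <= t]].
Proof.
move=> hs; split; first by exists (mdist x (s 0) - 0), 0 => /=.
exists (- mdist x (s 0)) => _ [t /= t0 <-].
have := metric_triangle (s 0) x (s t).
by rewrite (ray_dist hs) ?lexx// (metric_sym _ x); lra.
Qed.

Lemma buse_le s x t : is_ray s -> 0 <= t -> buse s x <= mdist x (s t) - t.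
Proof.
by move=> hs t0; apply: ge_inf; [exact: (buse_has_inf x hs).2|exists t].
Qed.

Lemma buse_near s x e : is_ray s -> 0 < e -> exists2 S, 0 <= S &
  forall t, S <= t -> mdist x (s t) - t <= buse s x + e.
Proof.
move=> hs e0; have [_ [S /= S0 <-] hS] := inf_adherent e0 (buse_has_inf x hs).
exists S => // t St; have := metric_triangle x (s S) (s t).
by rewrite (ray_dist hs) ?S0//; move: hS; rewrite -/(buse s x); lra.
Qed.

Lemma le_buse s x r : is_ray s ->
  (forall t, 0 <= t -> r <= mdist x (s t) - t) -> r <= buse s x.
Proof.
move=> hs h; apply: lb_le_inf; first exact: (buse_has_inf x hs).1.
by move=> _ [t /= t0 <-]; exact: h.
Qed.

Lemma buse_lip s x y : is_ray s -> buse s x <= buse s y + mdist x y.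
Proof.
move=> hs; rewrite -lerBlDr; apply: le_buse => // t t0.
have := buse_le x hs t0; have := metric_triangle x y (s t); lra.
Qed.

Lemma buse_start s : is_ray s -> buse s (s 0) = 0.
Proof.
move=> hs; apply/eqP; rewrite eq_le; apply/andP; split.
  by have := buse_le (s 0) hs (lexx 0); rewrite mdistxx subr0.
by apply: le_buse => // t t0; rewrite (ray_dist hs) ?lexx//; lra.
Qed.

Lemma buse_isom (g : self_isometry T) s x : buse (g \o s) (g x) = buse s x.
Proof.
rewrite /buse; congr (inf _); apply/seteqP.
by split => _ [t t0 <-]; exists t => //=; rewrite isom_dist.
Qed.

Lemma isom_is_ray (g : self_isometry T) s : is_ray s -> is_ray (g \o s).
Proof. by move=> hs t u t0 u0 /=; rewrite isom_dist hs. Qed.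

Lemma busemannE (xi : boundary T) x y :
  busemann xi x y = buse (ray_of xi) x - buse (ray_of xi) y.
Proof.
have hs := rayP (ray_of xi); rewrite /busemann.
apply: cvg_lim => //; apply/cvgrPdist_lt => /= e e0.
have e20 : 0 < e / 2 by rewrite divr_gt0.
have [S S0 hS] := buse_near x hs e20; have [S' S'0 hS'] := buse_near y hs e20.
near=> t.
have t0 : 0 <= t by near: t; apply: nbhs_pinfty_ge; rewrite num_real.
have St : S <= t by near: t; apply: nbhs_pinfty_ge; rewrite num_real.
have S't : S' <= t by near: t; apply: nbhs_pinfty_ge; rewrite num_real.
have := buse_le x hs t0; have := buse_le y hs t0.
have := hS _ St; have := hS' _ S't; rewrite ltr_norml => *.
by apply/andP; split; lra.
Unshelve. all: by end_near. Qed.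

Hypothesis cn : cn_ineq T.

(** Comparison of the point at ratio l on [x, y] with that on [x, y'].  Two
    uses of the inequality suffice, one for each of the two sides. *)
Lemma cn_scale x y y' z z' l : 0 <= l <= 1 ->
  mdist x z = l * mdist x y -> mdist z y = (1 - l) * mdist x y ->
  mdist x z' = l * mdist x y' -> mdist z' y' = (1 - l) * mdist x y' ->
  mdist z z' <= l * mdist y y'.
Proof.
move=> l01 xz zy xz' zy'.
have h1 := cn z' l01 xz zy; have h2 := cn y l01 xz' zy'.
apply: ler_of_sqr; first by have := mdist_ge0 y y'; nra.
rewrite metric_sym; apply: (le_trans h1).
rewrite (metric_sym z' x) xz' (metric_sym z' y); move: h2.
rewrite (metric_sym y x); move: (mdist y z') (mdist x y) (mdist x y') => a b b'.
move=> h2; have : l * a ^+ 2 <= l * ((1 - l) * b ^+ 2 + l * mdist y y' ^+ 2 -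
   l * (1 - l) * b' ^+ 2) by rewrite ler_wpM2l//; lra.
nra.
Qed.

(** Convexity of the distance to a point: the inequality gives the bound on the
    squares, since mdist x y is at least the difference of the two distances. *)
Lemma cn_convex x y z p l : 0 <= l <= 1 ->
  mdist x z = l * mdist x y -> mdist z y = (1 - l) * mdist x y ->
  mdist p z <= (1 - l) * mdist p x + l * mdist p y.
Proof.
move=> l01 xz zy; have h := cn p l01 xz zy.
have l1 : 0 <= l * (1 - l) by nra.
have := metric_triangle p x y; have := metric_triangle p y x.
rewrite (metric_sym y x).
have := mdist_ge0 p x; have := mdist_ge0 p y; have := mdist_ge0 x y.
move: h; move: (mdist p x) (mdist p y) (mdist x y) => a b d h d0 b0 a0 t1 t2.
apply: ler_of_sqr; first by nra.
apply: (le_trans h).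
have : l * (1 - l) * (a - b) ^+ 2 <= l * (1 - l) * d ^+ 2.
  by rewrite ler_wpM2l//; nra.
nra.
Qed.

Lemma buse_convex s x y z l : is_ray s -> 0 <= l <= 1 ->
  mdist x z = l * mdist x y -> mdist z y = (1 - l) * mdist x y ->
  buse s z <= (1 - l) * buse s x + l * buse s y.
Proof.
move=> hs l01 xz zy; apply/ler_addgt0Pr => e e0.
have [S S0 hS] := buse_near x hs e0; have [S' S'0 hS'] := buse_near y hs e0.
pose t := Num.max S S'.
have St : S <= t by rewrite le_max lexx.
have S't : S' <= t by rewrite le_max lexx orbT.
have := buse_le z hs (le_trans S0 St).
have := cn_convex (s t) l01 xz zy; rewrite !(metric_sym (s t)).
have := hS _ St; have := hS' _ S't.
move: (mdist x (s t)) (mdist y (s t)) (mdist z (s t)) => a b d h1 h2 h3 h4.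
by nra.
Qed.

(** The law of cosines with the third vertex q going to infinity on the
    continuation of the segment from p to x, up to an error that vanishes: the
    length of [p, q] cancels in the limit, and only the difference B of the
    distances of y and p to q remains. *)
Lemma cn_far_vertex y p x u B : 0 <= u ->
  (forall e M, 0 < e -> exists q w, [/\ M <= mdist p q, mdist p w = u,
     mdist w q = mdist p q - u, mdist w x <= e &
     mdist y q - mdist p q <= B + e]) ->
  mdist y x ^+ 2 <= mdist y p ^+ 2 + u ^+ 2 + 2 * u * B.
Proof.
move=> u0 h; apply/ler_addgt0Pr => e e0.
pose D := mdist y p; have D0 : 0 <= D by exact: mdist_ge0.
pose K := 2 * D + 4 * u + 1; have K0 : 0 < K by rewrite /K; lra.
pose e' := Num.min 1 (e / 2 / K).
have e'0 : 0 < e' by rewrite lt_min ltr01 !divr_gt0.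
have e'1 : e' <= 1 by rewrite ge_min lexx.
have e'K : e' * K <= e / 2 by rewrite -ler_pdivlMr// ge_min lexx orbT.
have [q [w [+ pw wq wx yq]]] := h e' (Num.max (u + 1) (u * D ^+ 2 / (e / 2))) e'0.
rewrite ge_max -/D => /andP[S1 S2]; set S := mdist p q in S1 S2 wq yq.
have S0 : 0 < S by lra.
have uS : u * D ^+ 2 / S <= e / 2.
  by rewrite ler_pdivrMr// [leRHS]mulrC -ler_pdivrMr ?divr_gt0.
have l01 : 0 <= u / S <= 1.
  by rewrite divr_ge0 ?(ltW S0)//= ler_pdivrMr// mul1r; lra.
have := @cn p q w y _ l01; rewrite -/S -/D mulrBl mul1r divfK ?gt_eqF//.
move=> /(_ pw wq) k1.
have k2 : mdist y w <= D + u by rewrite -pw metric_triangle.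
have k3 : mdist y x <= mdist y w + e'.
  by have := metric_triangle y w x; lra.
have k4 : mdist y x ^+ 2 <= mdist y w ^+ 2 + e' * (2 * (D + u) + 1).
  apply: (@le_trans _ _ ((mdist y w + e') ^+ 2)).
    by have := mdist_ge0 y x; nra.
  by have := mdist_ge0 y w; nra.
have aD : (mdist y q - S) ^+ 2 <= D ^+ 2.
  have := metric_triangle y p q; have := metric_triangle p y q.
  rewrite (metric_sym p y) -/D -/S => *; nra.
have k5 : u / S * mdist y q ^+ 2 <= u * S + 2 * u * (B + e') + u * D ^+ 2 / S.
  have -> : u / S * mdist y q ^+ 2 = u * S + 2 * u * (mdist y q - S)
     + u / S * (mdist y q - S) ^+ 2 by field; rewrite gt_eqF.
  rewrite [u * D ^+ 2 / S]mulrAC lerD//; last by rewrite ler_wpM2l//; case/andP: l01.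
  by rewrite lerD2l ler_wpM2l//; lra.
have k6 : u / S * (1 - u / S) * S ^+ 2 = u * S - u ^+ 2.
  by field; rewrite gt_eqF.
have k7 : (1 - u / S) * D ^+ 2 <= D ^+ 2.
  by case/andP: l01 => l0 _; have := sqr_ge0 D; nra.
rewrite k6 in k1; rewrite /K in e'K; rewrite -/D; lra.
Qed.

Lemma buse_quad s y u : is_ray s -> 0 <= u ->
  mdist y (s u) ^+ 2 <= mdist y (s 0) ^+ 2 + u ^+ 2 + 2 * u * buse s y.
Proof.
move=> hs u0; apply: cn_far_vertex => // e M e0.
have [S S0 hS] := buse_near y hs e0.
pose t := Num.max (Num.max S u) M.
have [St ut Mt] : [/\ S <= t, u <= t & M <= t].
  by rewrite /t !le_max !lexx !orbT.
exists (s t), (s u).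
rewrite !(ray_dist hs) ?lexx ?u0 ?(le_trans u0 ut)// !subr0 subrr.
by split=> //; rewrite ?(ltW e0) ?hS.
Qed.

(** Two asymptotic rays with the same origin stay at bounded distance, and at
    time t at most t / u times this bound, for every later time u. *)
Lemma ray_unique s s' : is_ray s -> is_ray s' -> s 0 = s' 0 -> asymp s s' ->
  forall t, 0 <= t -> s t = s' t.
Proof.
move=> hs hs' h0 [C hC] t; rewrite le_eqVlt => /orP[/eqP <-//|t0].
apply: mdist_positivity; apply/eqP; rewrite eq_le mdist_ge0 andbT.
apply/ler_addgt0Pr => e e0; rewrite add0r.
have C0 : 0 <= C by exact: le_trans (mdist_ge0 _ _) (hC 0 (lexx 0)).
pose u := Num.max t (t * C / e).
have tu : t <= u by rewrite le_max lexx.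
have u0 : 0 < u by lra.
have l01 : 0 <= t / u <= 1.
  by rewrite divr_ge0 ?(ltW u0) ?(ltW t0)//= ler_pdivrMr// mul1r.
have t0u : (0 : R) <= 0 <= u by rewrite lexx ltW.
have t0t : (0 : R) <= 0 <= t by rewrite lexx ltW.
have ttu : 0 <= t <= u by rewrite ltW.
have tu1 : t / u * u = t by rewrite divfK ?gt_eqF.
have := @cn_scale (s 0) (s u) (s' u) (s t) (s' t) _ l01.
rewrite !h0 !(ray_dist hs')// -!h0 !(ray_dist hs)// !subr0 mulrBl mul1r tu1.
move=> /(_ erefl erefl erefl erefl) h; apply: (le_trans h).
rewrite mulrAC ler_pdivrMr// (@le_trans _ _ (t * C))//.
  by rewrite ler_wpM2l ?(ltW t0)// hC// ltW.
by rewrite [leRHS]mulrC -ler_pdivrMr// le_max lexx orbT.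
Qed.

(** The extreme case of the law of cosines: an angle zero at infinity. *)
Lemma buse_eq_ray s c : is_ray s -> is_ray c -> s 0 = c 0 ->
  (forall t, 0 <= t -> buse s (c t) <= - t) -> forall t, 0 <= t -> s t = c t.
Proof.
move=> hs hc h0 h t t0; apply: mdist_positivity; apply/eqP.
rewrite -sqrf_eq0 eq_le sqr_ge0 andbT metric_sym.
apply: (le_trans (buse_quad _ hs t0)).
rewrite h0 metric_sym (ray_dist hc) ?lexx// subr0.
by have := h t t0; nra.
Qed.

End rays.

(** * Limits of geodesics and asymptotic rays *)

Section limit_rays.
Context (R : realType) (T : metricType R).
Hypotheses (cn : cn_ineq T) (geo : geodesic_space T) (hprop : proper_space T).
Implicit Types (x y z p : T) (l t u : R) (s c : R -> T).

Definition diverges (L : nat -> R) :=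
  forall M, exists N, forall n, (N <= n)%N -> M <= L n.

(** Limits along an ultrafilter exist in all bounded sets at once, which
    replaces the extraction of diagonal subsequences. *)
Lemma ultra_cvg (U : set_system nat) (f : nat -> T) p r : UltraFilter U ->
  U [set n | mdist p (f n) <= r] ->
  exists q, forall e, 0 < e -> U [set n | mdist (f n) q < e].
Proof.
move=> UU hU; have [q [_ hq]] := @hprop p r (f @ U) _ hU.
exists q => e e0; have [//|hC] := in_ultra_setVsetC [set n | mdist (f n) q < e] UU.
have [] := hq (f @` (~` [set n | mdist (f n) q < e])) (ball q e).
- by apply: (@filterS _ U _ _ _ _ hC) => n hn; exists n.
- exact: nbhsx_ballx.
by move=> _ [[n hn <-]]; rewrite ballEmdist /= metric_sym.
Qed.

(** Geodesic segments of growing length from a common origin accumulate on a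
    ray, pointwise in time. *)
Lemma ray_cluster (tau : nat -> R -> T) (L : nat -> R) p :
  (forall n t u, 0 <= t <= L n -> 0 <= u <= L n ->
    mdist (tau n t) (tau n u) = `|t - u|) ->
  (forall n, tau n 0 = p) -> diverges L ->
  exists s, [/\ is_ray s, s 0 = p & forall t e N, 0 <= t -> 0 < e ->
    exists n, [/\ (N <= n)%N, t <= L n & mdist (tau n t) (s t) < e]].
Proof.
move=> hiso h0 hL; have [U [UU sU]] := ultraFilterLemma eventually_filter.
have ev N : U [set n | (N <= n)%N] by apply: sU; exists N.
have evL t : U [set n | t <= L n].
  by have [N hN] := hL t; apply: filterS (ev N) => n /hN.
have ht t : exists q, 0 <= t ->
    forall e, 0 < e -> U [set n | mdist (tau n t) q < e].
  have [t0|t0] := lerP 0 t; last by exists p.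
  have [|q hq] := @ultra_cvg U (fun n => tau n t) p t UU; last by exists q.
  apply: filterS (evL t) => n /= tL; rewrite -(h0 n) hiso ?lexx ?t0//.
    by rewrite sub0r normrN ger0_norm.
  exact: le_trans tL.
have [s hs] := choice ht; exists s; split.
- move=> t u t0 u0; apply/eqP; rewrite -subr_eq0 -normr_eq0 eq_le normr_ge0 andbT.
  apply/ler_addgt0Pr => e e0; rewrite add0r.
  have e20 : 0 < e / 2 by lra.
  have [n [[/= h1 h2] [/= h3 h4]]] := filter_ex (filterI
    (filterI (hs t t0 _ e20) (hs u u0 _ e20)) (filterI (evL t) (evL u))).
  have <- : mdist (tau n t) (tau n u) = `|t - u| by rewrite hiso ?t0 ?u0.
  have := metric_triangle (s t) (tau n t) (s u).
  have := metric_triangle (tau n t) (tau n u) (s u).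
  have := metric_triangle (tau n t) (s t) (tau n u).
  have := metric_triangle (s t) (s u) (tau n u).
  rewrite !(metric_sym (s t) (tau n t)) !(metric_sym (s u) (tau n u)) => *.
  by rewrite ler_norml; apply/andP; split; lra.
- apply: mdist_positivity; apply/eqP; rewrite eq_le mdist_ge0 andbT.
  apply/ler_addgt0Pr => e e0; rewrite add0r metric_sym.
  by have [n /=] := filter_ex (hs 0 (lexx 0) e e0); rewrite h0 => /ltW.
- move=> t e N t0 e0.
  have [n [/= h1 [/= h2 h3]]] := filter_ex (filterI (hs t t0 _ e0)
    (filterI (evL t) (ev N))).
  by exists n.
Qed.

Lemma limit_ray (x : nat -> T) p : diverges (fun n => mdist p (x n)) ->
  exists s, [/\ is_ray s, s 0 = p & forall t e N, 0 <= t -> 0 < e ->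
    exists n c, [/\ (N <= n)%N, is_geodesic c (mdist p (x n)) p (x n),
      t <= mdist p (x n) & mdist (c t) (s t) < e]].
Proof.
move=> hx.
have hc n : exists c, is_geodesic c (mdist p (x n)) p (x n).
  by have [c [l hc]] := geo p (x n); exists c; rewrite (geodesic_length hc).
have [c {}hc] := choice hc.
have [||s [hs s0 h]] := @ray_cluster c (fun n => mdist p (x n)) p _ _ hx.
- by move=> n t u; have [_ _ _] := hc n; apply.
- by move=> n; case: (hc n).
exists s; split=> // t e N t0 e0; have [n [? ? ?]] := h t e N t0 e0.
by exists n, (c n).
Qed.

Lemma geodesic_ratio x y c D l : is_geodesic c D x y -> 0 <= l <= 1 ->
  mdist x (c (l * D)) = l * D /\ mdist (c (l * D)) y = (1 - l) * D.
Proof.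
move=> [D0 <- <- h] l01.
have lD : 0 <= l * D <= D by nra.
rewrite !h ?lexx ?D0// sub0r normrN ger0_norm; last by case/andP: lD.
split=> //; rewrite distrC ger0_norm; first by ring.
by rewrite subr_ge0; case/andP: lD.
Qed.

(** A geodesic from a point p to a far point of a ray tracks the ray: both end
    at s u, and they start at distance at most C. *)
Lemma geodesic_near_ray p s c u t C : is_ray s -> 0 < u -> 0 <= t <= u ->
  mdist p (s 0) <= C -> is_geodesic c (mdist p (s u)) p (s u) ->
  mdist (c (t / u * mdist p (s u))) (s t) <= C.
Proof.
move=> hs u0 /andP[t0 tu] hC hc; set D := mdist p (s u) in hc *.
have l01 : 0 <= t / u <= 1 by rewrite divr_ge0 ?(ltW u0)//= ler_pdivrMr// mul1r.
have l01' : 0 <= 1 - t / u <= 1 by lra.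
have [h1 h2] := geodesic_ratio hc l01.
have := @cn_scale R T cn (s u) p (s 0) (c (t / u * D)) (s t) _ l01'.
rewrite !(metric_sym (s u)) -/D h2 (metric_sym _ p) h1 (metric_sym _ (s 0)).
rewrite !(ray_dist hs) ?lexx ?t0 ?(ltW u0)// !subr0 opprB addrCA subrr addr0.
move=> /(_ erefl erefl) h.
apply: (le_trans (h _ _)); first by field; rewrite gt_eqF.
  by field; rewrite gt_eqF.
have := mdist_ge0 p (s 0); nra.
Qed.

Lemma geodesic_shift x y c D t u : is_geodesic c D x y -> 0 < u ->
  0 <= t <= u -> t <= D -> mdist (c t) (c (t / u * D)) <= t / u * `|D - u|.
Proof.
move=> [D0 _ _ h] u0 /andP[t0 tu] tD.
have l01 : 0 <= t / u <= 1 by rewrite divr_ge0 ?(ltW u0)//= ler_pdivrMr// mul1r.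
rewrite h ?t0//; last by nra.
have -> : t - t / u * D = t / u * (u - D) by field; rewrite gt_eqF.
by rewrite normrM (distrC D) ger0_norm//; case/andP: l01.
Qed.

(** The geodesics from p to the points of a ray accumulate on a ray from p in
    the same class. *)
Lemma asymp_ray s p : is_ray s ->
  exists s', [/\ is_ray s', s' 0 = p & asymp s' s].
Proof.
move=> hs; pose C := mdist p (s 0).
have hsn n : mdist (s 0) (s n%:R) = n%:R.
  by rewrite (ray_dist hs) ?lexx ?ler0n// subr0.
have hD n : `|mdist p (s n%:R) - n%:R| <= C.
  have := metric_triangle p (s 0) (s n%:R).
  have := metric_triangle (s 0) p (s n%:R).
  rewrite hsn (metric_sym (s 0)) -/C ler_norml => *.
  by apply/andP; split; lra.
have [|s' [hs' s'0 h]] := @limit_ray (fun n => s n%:R) p.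
  move=> M; pose N := Num.truncn (`|M| + C); exists N.+1 => n Nn.
  have := hD n; rewrite ler_norml => /andP[+ _].
  have : (N.+1%:R : R) <= n%:R by rewrite ler_nat.
  have := truncnS_gt (`|M| + C); rewrite -/N.
  by have := ler_norm M; lra.
exists s'; split => //; exists (C + C + 1) => t t0.
have [n [c [Nn hc tD hct]]] := h t 1 (Num.truncn t).+1 t0 ltr01.
have tn : t < n%:R.
  by apply: (lt_le_trans (truncnS_gt t)); rewrite ler_nat.
have n0 : 0 < n%:R :> R by lra.
have ttn : 0 <= t <= n%:R by rewrite t0 ltW.
have h1 := geodesic_near_ray hs n0 ttn (lexx C) hc.
have h2 := geodesic_shift hc n0 ttn tD.
have h3 : t / n%:R * `|mdist p (s n%:R) - n%:R| <= C.
  apply: le_trans (hD n); rewrite ler_piMl// ler_pdivrMr//; lra.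
have := metric_triangle (s' t) (c t) (s t).
have := metric_triangle (c t) (c (t / n%:R * mdist p (s n%:R))) (s t).
by rewrite (metric_sym (s' t) (c t)); lra.
Qed.

(** The geodesics from s 0 to the points of an asymptotic ray s' converge to s, so
    that these points can serve as far vertices in the law of cosines. *)
Lemma buse_quad_asymp s s' y u :
  is_ray s -> is_ray s' -> asymp s s' -> 0 <= u ->
  mdist y (s u) ^+ 2 <= mdist y (s 0) ^+ 2 + u ^+ 2
    + 2 * u * (buse s' y - buse s' (s 0)).
Proof.
move=> hs hs' [C hC] t0; apply: cn_far_vertex => // e M e0.
have C0 : 0 <= C by exact: le_trans (mdist_ge0 _ _) (hC 0 (lexx 0)).
have [S S0 hS] := buse_near y hs' e0.
pose v := Num.max (Num.max S 1)
  (Num.max (u + C) (Num.max (2 * u * C / e) (M + C))).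
have [vS v1 uv vC vM] :
    [/\ S <= v, 1 <= v, u + C <= v, 2 * u * C / e <= v & M + C <= v].
  by rewrite /v !le_max !lexx !orbT.
have v0 : 0 < v by lra.
have [c [D hc]] := geo (s 0) (s' v); have DE := geodesic_length hc.
rewrite -DE in hc.
have hD : `|mdist (s 0) (s' v) - v| <= C.
  have := metric_triangle (s 0) (s v) (s' v).
  have := metric_triangle (s 0) (s' v) (s v).
  have := hC v (ltW v0).
  rewrite (ray_dist hs) ?lexx ?(ltW v0)// (metric_sym (s' v)) ler_norml => *.
  by apply/andP; split; lra.
have [uD MD] : u <= mdist (s 0) (s' v) /\ M <= mdist (s 0) (s' v).
  by move: hD; rewrite ler_norml => /andP[]; lra.
have uv' : u <= v by lra.
have tuv : 0 <= u <= v by rewrite t0.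
have h2 := geodesic_shift hc v0 tuv uD.
(* The point at distance u on [s 0, s' v] is compared with s u through
   [s 0, s v]: both geodesics start at s 0. *)
have l01 : 0 <= u / v <= 1 by rewrite divr_ge0 ?(ltW v0)//= ler_pdivrMr// mul1r.
have h1 : mdist (c (u / v * mdist (s 0) (s' v))) (s u) <= u / v * C.
  have [g1 g2] := geodesic_ratio hc l01.
  apply: le_trans (ler_wpM2l _ (hC v (ltW v0))); last by case/andP: l01.
  rewrite (metric_sym (s v)); apply: (@cn_scale R T cn _ _ _ _ _ _ l01 g1 g2).
    by rewrite !(ray_dist hs) ?lexx ?t0 ?(ltW v0)// !subr0 divfK ?gt_eqF.
  rewrite !(ray_dist hs) ?lexx ?(ltW v0)// subr0 mulrBl mul1r.
  by rewrite divfK ?gt_eqF.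
have h3 : u / v * `|mdist (s 0) (s' v) - v| <= u / v * C.
  by rewrite ler_wpM2l//; case/andP: l01.
have h4 : 2 * (u / v * C) <= e.
  rewrite mulrA mulrA mulrAC ler_pdivrMr//.
  by move: vC; rewrite ler_pdivrMr// (mulrC v).
have [D0 cs cv hcd] := hc.
exists (s' v), (c u); split => //.
- by rewrite -{1}cs hcd ?t0 ?D0 ?lexx// sub0r normrN ger0_norm.
- by rewrite -{1}cv hcd ?t0 ?D0 ?lexx// distrC ger0_norm ?subr_ge0.
- by have := metric_triangle (c u) (c (u / v * mdist (s 0) (s' v))) (s u); lra.
have := hS v vS; have := buse_le (s 0) hs' (ltW v0); lra.
Qed.

(** The Busemann functions of asymptotic rays differ by a constant.  Comparing
    the two estimates of the distance from z to r t, one by the Busemann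
    function of r and one by the law of cosines along r', gives an inequality
    between both functions as t goes to infinity; exchanging the rays gives the
    opposite one up to constants, which are matched along s'. *)
Lemma buse_shift s s' y : is_ray s -> is_ray s' -> asymp s s' ->
  buse s' y = buse s y + buse s' (s 0).
Proof.
have le1 (r r' : R -> T) z : is_ray r -> is_ray r' -> asymp r r' ->
    buse r z <= buse r' z - buse r' (r 0).
  move=> hr hr' a; apply/ler_addgt0Pr => e e0.
  have D0 := sqr_ge0 (mdist z (r 0)).
  pose t := Num.max (mdist z (r 0) ^+ 2 / (2 * e)) (Num.max (mdist z (r 0)) 1).
  have [t1 t2 t3] : [/\ mdist z (r 0) ^+ 2 / (2 * e) <= t, mdist z (r 0) <= t
      & 1 <= t] by rewrite /t !le_max !lexx !orbT.
  have t0 : 0 <= t by lra.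
  have := buse_quad_asymp z hr hr' a t0.
  have := buse_le z hr t0; have := buse_lip (r 0) z hr.
  rewrite buse_start// (metric_sym (r 0)); move: t1.
  rewrite ler_pdivrMr; last by lra.
  move: (buse r z) (mdist z (r t)) (mdist z (r 0)) t2 => b d D t2.
  set B := buse r' z - _ => k1 k2 k3 k4.
  have k5 : (t + b) ^+ 2 <= d ^+ 2 by nra.
  have : 2 * t * b <= 2 * t * (B + e) by have := sqr_ge0 b; lra.
  by rewrite ler_pM2l//; lra.
have le2 (r r' : R -> T) t : is_ray r -> is_ray r' -> asymp r r' -> 0 <= t ->
    buse r (r' t) <= buse r (r' 0) - t.
  move=> hr hr' a t0; pose q u := r' (t + u).
  have hq : is_ray q.
    by move=> u v u0 v0; rewrite hr' ?addr_ge0// opprD addrACA subrr add0r.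
  have aq : asymp q r.
    apply: asymp_trans (asymp_sym a); exists t => u u0.
    by rewrite hr' ?addr_ge0// addrK ger0_norm.
  have := le1 q r (r' 0) hq hr aq; rewrite {2}/q addr0.
  have : t <= buse q (r' 0).
    apply: le_buse => // u u0; rewrite (ray_dist hr') ?lexx ?addr_ge0//.
    by rewrite subr0 addrK.
  lra.
move=> hs hs' a; have a' := asymp_sym a.
have : - buse s (s' 0) <= buse s' (s 0).
  apply: le_buse => // t t0; have := le2 _ _ t hs hs' a t0.
  by have := buse_lip (s 0) (s' t) hs; rewrite buse_start//; lra.
by have := le1 _ _ y hs hs' a; have := le1 _ _ y hs' hs a'; lra.
Qed.

(** A Busemann function that is sublinear on the sequence x is, by convexity,
    almost bounded by its value at p on bounded parts of the geodesics from p
    to the points x n. *)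
Lemma limit_ray_le (x : nat -> T) p : diverges (fun n => mdist p (x n)) ->
  exists s, [/\ is_ray s, s 0 = p & forall r, is_ray r ->
    (forall e, 0 < e -> exists N, forall n, (N <= n)%N ->
       buse r (x n) <= e * mdist p (x n)) ->
    forall t, 0 <= t -> buse r (s t) <= buse r p].
Proof.
move=> hx; have [s [hs s0 h]] := limit_ray hx; exists s; split => // r hr hsub.
move=> t t0; apply/ler_addgt0Pr => e e0.
pose e' := e / (3 * (t + 1)).
have t1 : 0 < 3 * (t + 1) by lra.
have e'0 : 0 < e' by rewrite /e' divr_gt0.
have e30 : 0 < e / 3 by lra.
have [N1 hN1] := hsub e' e'0.
have [N2 hN2] := hx (Num.max 1 (t * `|buse r p| / (e / 3))).
have [n [c [Nn hc tD hct]]] := h t (e / 3) (maxn N1 N2) t0 e30.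
move: Nn; rewrite geq_max => /andP[/hN1 + /hN2].
set D := mdist p (x n) in hc tD *; rewrite ge_max => k1 /andP[D1 k2].
have D0 : 0 < D by lra.
have l01 : 0 <= t / D <= 1 by rewrite divr_ge0 ?(ltW D0)//= ler_pdivrMr// mul1r.
have [g1 g2] := geodesic_ratio hc l01.
have := buse_convex cn hr l01 g1 g2; rewrite divfK ?gt_eqF// => k3.
have k4 : t / D * buse r (x n) <= e / 3.
  apply: (@le_trans _ _ (t / D * (e' * D))).
    by rewrite ler_wpM2l//; case/andP: l01.
  have -> : t / D * (e' * D) = t * e' by field; rewrite gt_eqF.
  have : 3 * (t + 1) * e' = e by rewrite /e' mulrC divfK ?gt_eqF.
  by nra.
have k5 : t / D * `|buse r p| <= e / 3.
  by rewrite mulrAC ler_pdivrMr// [leRHS]mulrC -ler_pdivrMr.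
have k6 : - (t / D * buse r p) <= t / D * `|buse r p|.
  rewrite -mulrN ler_wpM2l//; first by case/andP: l01.
  by rewrite -normrN ler_norm.
have := buse_lip (s t) (c t) hr; rewrite (metric_sym (s t)); lra.
Qed.

End limit_rays.

(** * Flat half planes *)

Section slope.
Context (R : realType).
Implicit Types (f : R -> R).

Definition convex_fun f := forall x y z, x <= y -> y <= z ->
  (z - x) * f y <= (z - y) * f x + (y - x) * f z.

(** m is the slope of f at minus infinity, for convex f the infimum of all
    its slopes. *)
Definition initial_slope f m :=
  (forall x y, x <= y -> m * (y - x) <= f y - f x) /\
  (forall e, 0 < e -> exists z, forall x y, x <= y -> y <= z ->
     f y - f x <= (m + e) * (y - x)).

Lemma convex_slopes f x y z w a : convex_fun f -> x <= y -> y <= z -> z < w ->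
  f w - f z <= a * (w - z) -> f y - f x <= a * (y - x).
Proof.
move=> cf xy yz zw h.
have yw : 0 < w - y by lra.
have zw' : 0 < w - z by lra.
have h1 : f w - f y <= a * (w - y).
  rewrite -(ler_pM2l zw'); have := cf y z w yz (ltW zw).
  have : (w - y) * (f w - f z) <= (w - y) * (a * (w - z)).
    by rewrite ler_wpM2l// ltW.
  by nra.
have := cf x y w xy (le_trans yz (ltW zw)).
have : (y - x) * (f w - f y) <= (y - x) * (a * (w - y)).
  by rewrite ler_wpM2l// subr_ge0.
rewrite -(ler_pM2l yw); nra.
Qed.

Lemma initial_slope_ex f :
  convex_fun f -> (forall x y, f x - f y <= `|x - y|) ->
  exists m, -1 <= m <= 1 /\ initial_slope f m.
Proof.
move=> cf lf.
pose S := [set m | exists x y, x < y /\ m = (f y - f x) / (y - x)].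
have lb m : S m -> -1 <= m.
  move=> [x [y [xy ->]]]; rewrite ler_pdivlMr ?subr_gt0//.
  by have := lf x y; rewrite distrC gtr0_norm ?subr_gt0//; lra.
have S0 : S ((f 1 - f 0) / (1 - 0)) by exists 0, 1.
have hS : has_inf S by split; [exists ((f 1 - f 0) / (1 - 0))|exists (-1)].
exists (inf S); split; last split.
- apply/andP; split; first by apply: lb_le_inf; [exists ((f 1 - f 0) / (1 - 0))|].
  apply: le_trans (ge_inf hS.2 S0) _; rewrite subr0 divr1.
  by have := lf 1 0; rewrite subr0 normr1.
- move=> x y; rewrite le_eqVlt => /orP[/eqP ->|xy]; first by rewrite !subrr mulr0.
  rewrite -ler_pdivlMr ?subr_gt0//; apply: ge_inf; first exact: hS.2.
  by exists x, y.
- move=> e e0; have [_ [z [w [zw ->]]] hm] := inf_adherent e0 hS.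
  exists z => x y xy yz; apply: (convex_slopes cf xy yz zw).
  by rewrite -ler_pdivrMr ?subr_gt0// ltW.
Qed.

End slope.

Section lines.
Context (R : realType) (T : metricType R).
Hypotheses (cn : cn_ineq T) (geo : geodesic_space T) (hprop : proper_space T).
Implicit Types (x y z p : T) (l t u : R) (s c : R -> T).

Lemma line_is_ray c : is_line c -> is_ray c.
Proof. by move=> hc t u _ _; exact: hc. Qed.

Definition rev_line c t := c (- t).

Lemma rev_is_line c : is_line c -> is_line (rev_line c).
Proof. by move=> hc t u; rewrite hc opprK addrC distrC. Qed.

Lemma buse_line_convex s c : is_ray s -> is_line c -> convex_fun (buse s \o c).
Proof.
move=> hs hc x y z xy yz /=; have [xz|xz] := eqVneq x z.
  have -> : y = z by lra.
  by rewrite xz subrr !mul0r addr0.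
have xz0 : 0 < z - x by rewrite subr_gt0 lt_neqAle xz (le_trans xy).
have l01 : 0 <= (y - x) / (z - x) <= 1.
  by rewrite divr_ge0 ?subr_ge0 ?(le_trans xy)//= ler_pdivrMr// mul1r lerD2r.
have := @buse_convex R T cn s (c x) (c z) (c y) _ hs l01.
rewrite !hc !(distrC x) (distrC y z) !ger0_norm ?subr_ge0//;
  last exact: le_trans yz.
rewrite [(1 - _) * (z - x)]mulrBl mul1r divfK ?gt_eqF// => h.
have {}h := h erefl ltac:(lra).
apply: (le_trans (ler_wpM2l (ltW xz0) h)).
by rewrite le_eqVlt; apply/orP; left; apply/eqP; field; rewrite gt_eqF.
Qed.

Lemma buse_line_slope s c : is_ray s -> is_line c ->
  exists m, -1 <= m <= 1 /\ initial_slope (buse s \o c) m.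
Proof.
move=> hs hc; apply: initial_slope_ex; first exact: buse_line_convex.
by move=> x y /=; have := buse_lip (c x) (c y) hs; rewrite hc; lra.
Qed.

(** A Busemann function that is affine along a line, with slope m in ]-1, 1[,
    spans a flat half plane: its points are reached by the rays in the class
    of s that start on the line, all at the angle arccos (- m) with it.  The
    CAT(0) inequality makes the candidate map F from the Euclidean half plane
    non-expanding.  It preserves the distance from a point of a ray to the
    origin of this ray, and by convexity to all points of the line; as a
    non-horizontal segment extends to the line, it preserves all distances. *)
Lemma flat_half_plane s c m : is_ray s -> is_line c -> -1 < m -> m < 1 ->
  (forall t, buse s (c t) = buse s (c 0) + m * t) -> bounds_flat_half_plane c.
Proof.
move=> hs hc m1 m2 hm.
have /choice[tau htau] t : exists s', [/\ is_ray s', s' 0 = c t & asymp s' s].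
  exact: asymp_ray.
have hr t : is_ray (tau t) by case: (htau t).
have h0 t : tau t 0 = c t by case: (htau t).
have hb t y : buse s y = buse (tau t) y + buse s (c t).
  by case: (htau t) => ? <- ?; exact: buse_shift.
have cc t t' : mdist (c t) (c t') ^+ 2 = (t - t') ^+ 2.
  by rewrite hc real_normK ?num_real.
have up0 t u t' : 0 <= u ->
    mdist (c t') (tau t u) ^+ 2
      <= (t - t') ^+ 2 + u ^+ 2 + 2 * u * (m * (t' - t)).
  move=> u0; have := buse_quad cn (c t') (hr t) u0; rewrite h0 cc.
  by have := hb t (c t'); rewrite (hm t) (hm t'); nra.
have up1 t u t' u' : 0 <= u -> 0 <= u' -> mdist (tau t' u') (tau t u) ^+ 2 <=
    (t - t') ^+ 2 + (u - u') ^+ 2 + 2 * m * (u' - u) * (t - t').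
  move=> u0 u'0; have := buse_quad cn (tau t' u') (hr t) u0.
  have := up0 t' u' t u'0; have := hb t (tau t' u'); have := hb t' (tau t' u').
  have := buse_le (tau t' u') (hr t') u'0; rewrite mdistxx sub0r h0.
  rewrite (metric_sym (c t)) (hm t) (hm t') => k1 k2 k3 k4 k5.
  have : u * buse (tau t) (tau t' u') <= u * (m * (t' - t) - u').
    by rewrite ler_wpM2l//; lra.
  nra.
pose w := Num.sqrt (1 - m ^+ 2).
have w2 : w ^+ 2 = 1 - m ^+ 2 by rewrite sqr_sqrtr//; nra.
have w0 : 0 < w by rewrite sqrtr_gt0; nra.
pose F (p : euclidean_plane R) : T := tau (p.1 + m * (p.2 / w)) (p.2 / w).
pose E (p q : euclidean_plane R) : R := (p.1 - q.1) ^+ 2 + (p.2 - q.2) ^+ 2.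
have EE (p q : euclidean_plane R) : mdist p q ^+ 2 = E p q.
  by case: p => ? ?; case: q => ? ?; rewrite plane_dist_sqr.
have F0 a : F (a, 0) = c a by rewrite /F /= mul0r mulr0 addr0 h0.
have pw a : 0 <= a -> 0 <= a / w by move=> a0; rewrite divr_ge0// ltW.
have up (p q : euclidean_plane R) : 0 <= p.2 -> 0 <= q.2 ->
    mdist (F p) (F q) ^+ 2 <= E p q.
  move=> p0 q0; have := up1 (q.1 + m * (q.2 / w)) (q.2 / w)
    (p.1 + m * (p.2 / w)) (p.2 / w) (pw _ q0) (pw _ p0).
  rewrite -/(F p) -/(F q) => h; apply: (le_trans h).
  rewrite le_eqVlt; apply/orP; left; apply/eqP; rewrite /E.
  have -> : p.2 - q.2 = w * (p.2 / w - q.2 / w) by field; rewrite gt_eqF.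
  by rewrite exprMn w2; ring.
(* The origin c t of the ray through F q is at distance exactly u from F q; it
   is the midpoint of c a and c (2 * t - a), and the inequality cn at F q turns
   the upper bound at the latter point into the lower bound at the former. *)
have low (q : euclidean_plane R) a : 0 <= q.2 ->
    mdist (F q) (c a) ^+ 2 = E q (a, 0).
  move=> q0; apply/eqP; rewrite eq_le -{1}F0 up//=.
  pose u := q.2 / w; pose t := q.1 + m * u.
  have u0 : 0 <= u by exact: pw.
  have qu : q.2 = w * u by rewrite /u; field; rewrite gt_eqF.
  have dt : mdist (F q) (c t) = u.
    by rewrite metric_sym -h0 (ray_dist (hr t)) ?lexx// subr0.
  have h2 : 0 <= (1 / 2 : R) <= 1 by apply/andP; split; lra.
  have := @cn (c a) (c (2 * t - a)) (c t) (F q) _ h2.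
  have e1 : `|a - (2 * t - a)| = 2 * `|a - t|.
    have -> : a - (2 * t - a) = 2 * (a - t) by ring.
    by rewrite normrM ger0_norm.
  have e2 : `|t - (2 * t - a)| = `|a - t|.
    by have -> : t - (2 * t - a) = a - t by ring.
  rewrite !hc e1 e2 => h.
  have {}h := h ltac:(lra) ltac:(lra).
  have := up q (2 * t - a, 0) q0 (lexx 0); rewrite F0 /E /=.
  have sq : `|a - t| ^+ 2 = (a - t) ^+ 2 by rewrite real_normK ?num_real.
  have q1 : q.1 = t - m * u by rewrite /t; ring.
  have q2 : q.2 ^+ 2 = (1 - m ^+ 2) * u ^+ 2 by rewrite qu exprMn w2.
  move: h; rewrite dt q1 !subr0 q2; move: sq.
  move: (mdist _ _) (mdist _ _) `|a - t| => d d' v sq; nra.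
have low1 (p q : euclidean_plane R) : 0 <= p.2 -> p.2 < q.2 ->
    mdist p q <= mdist (F p) (F q).
  move=> p0 pq; have q0 : 0 < q.2 by lra.
  (* The line through p and q meets the axis at a; p is on the segment
     from there to q, at the ratio k. *)
  pose k := p.2 / q.2.
  have kq : k * q.2 = p.2 by rewrite /k divfK ?gt_eqF.
  have k01 : 0 <= k < 1.
    by rewrite divr_ge0 ?(ltW q0)//= ltr_pdivrMr// mul1r.
  case/andP: k01 => k0 k1.
  have k1' : 1 - k != 0 by rewrite subr_eq0 gt_eqF.
  pose a := (p.1 - k * q.1) / (1 - k).
  have ka : (1 - k) * a = p.1 - k * q.1 by rewrite /a; field.
  have hp := low p a p0; have hq := low q a (ltW q0).
  have ep : E p (a, 0) = k ^+ 2 * E q (a, 0).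
    rewrite /E /= !subr0 -kq.
    have -> : p.1 - a = k * (q.1 - a) by lra.
    by ring.
  have epq : E p q = (1 - k) ^+ 2 * E q (a, 0).
    rewrite /E /= !subr0 -kq.
    have -> : p.1 - q.1 = - ((1 - k) * (q.1 - a)) by lra.
    by ring.
  have dp : mdist (F p) (c a) = k * mdist (F q) (c a).
    apply: eqr_of_sqr; [exact: mdist_ge0|by rewrite mulr_ge0 ?mdist_ge0|].
    by rewrite hp exprMn hq ep.
  have dpq : mdist p q = (1 - k) * mdist (F q) (c a).
    apply: eqr_of_sqr; first exact: mdist_ge0.
      by rewrite mulr_ge0 ?mdist_ge0// subr_ge0 ltW.
    by rewrite EE exprMn hq epq.
  have := metric_triangle (F q) (F p) (c a).
  by rewrite dp dpq (metric_sym (F q) (F p)); lra.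
have low2 (p q : euclidean_plane R) : 0 <= p.2 -> p.2 <= q.2 ->
    mdist p q <= mdist (F p) (F q).
  move=> p0; rewrite le_eqVlt => /orP[/eqP pq|]; last exact: low1.
  (* On a horizontal segment, raise one end a little. *)
  have q0 : 0 <= q.2 by rewrite -pq.
  apply/ler_addgt0Pr => e e0.
  have e20 : 0 < e / 2 by lra.
  pose q' : euclidean_plane R := (q.1, q.2 + e / 2).
  have pq' : p.2 < q'.2 by rewrite /= pq; lra.
  have qq : mdist q q' = e / 2.
    apply: eqr_of_sqr; [exact: mdist_ge0|exact: ltW|].
    by rewrite EE /E /=; ring.
  have fqq : mdist (F q) (F q') <= e / 2.
    by apply: ler_of_sqr; [exact: ltW|rewrite -qq EE up//= ; lra].
  have := low1 p q' p0 pq'; have := metric_triangle p q' q.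
  have := metric_triangle (F p) (F q) (F q').
  by rewrite (metric_sym q' q); lra.
exists F; split=> // p q p0 q0.
apply/eqP; rewrite eq_le; apply/andP; split.
  by apply: ler_of_sqr; rewrite ?mdist_ge0// EE up.
have [pq|qp] := leP p.2 q.2; first exact: low2.
by rewrite (metric_sym p) (metric_sym (F p)) low2// ltW.
Qed.

(** Busemann functions depend continuously on the ray, because the law of
    cosines bounds the speed at which their defining limits are attained in
    terms of the distance from y to the origin only. *)
Lemma buse_limit (tau : nat -> R -> T) s y b : (forall n, is_ray (tau n)) ->
  is_ray s -> (forall n, tau n 0 = s 0) ->
  (forall t e N, 0 <= t -> 0 < e ->
     exists n, (N <= n)%N /\ mdist (tau n t) (s t) < e) ->
  (forall e, 0 < e -> exists N, forall n, (N <= n)%N ->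
     `|buse (tau n) y - b| <= e) -> buse s y = b.
Proof.
move=> htau hs h0 hcl hb; apply/eqP; rewrite eq_le; apply/andP; split.
  apply/ler_addgt0Pr => e e0; have e30 : 0 < e / 3 by lra.
  have D0 := sqr_ge0 (mdist y (s 0)).
  pose t := Num.max (mdist y (s 0) ^+ 2 / (2 * (e / 3)))
                    (Num.max (mdist y (s 0) + e) 1).
  have [t1 t2 t3] : [/\ mdist y (s 0) ^+ 2 / (2 * (e / 3)) <= t,
      mdist y (s 0) + e <= t & 1 <= t] by rewrite /t !le_max !lexx !orbT.
  have t0 : 0 <= t by lra.
  have [N hN] := hb _ e30; have [n [Nn hn]] := hcl t (e / 3) N t0 e30.
  have := hN n Nn; rewrite ler_norml => /andP[_ k1].
  have := buse_quad cn y (htau n) t0; rewrite h0 => k2.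
  have := buse_le y hs t0; have := buse_lip (s 0) y hs.
  have := metric_triangle y (tau n t) (s t).
  rewrite buse_start// (metric_sym (s 0)); move: t1.
  rewrite ler_pdivrMr; last by lra.
  set B := buse s y; move: t2 k2.
  set D := mdist y (s 0); set d := mdist y (tau n t); set d' := mdist y (s t).
  move=> t2 k2 k3 k4 k5 k6.
  have k7 : (t + B - e / 3) ^+ 2 <= d ^+ 2 by nra.
  have : 2 * t * (B - e / 3) <= 2 * t * (b + e / 3 + e / 3).
    have : t * buse (tau n) y <= t * (b + e / 3) by rewrite ler_wpM2l//; lra.
    by have := sqr_ge0 (B - e / 3); rewrite -/D in D0; lra.
  by rewrite ler_pM2l//; lra.
apply: le_buse => // t t0; apply/ler_addgt0Pr => e e0.
have e20 : 0 < e / 2 by lra.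
have [N hN] := hb _ e20; have [n [Nn hn]] := hcl t (e / 2) N t0 e20.
have := hN n Nn; rewrite ler_norml => /andP[k1 _].
have := buse_le y (htau n) t0; have := metric_triangle y (s t) (tau n t).
by rewrite (metric_sym (s t)); lra.
Qed.

End lines.

(** * Rank one axes *)

Section rank_one.
Context (R : realType) (T : metricType R).
Hypotheses (cn : cn_ineq T) (geo : geodesic_space T) (hprop : proper_space T).
Implicit Types (x y z p : T) (l t u : R) (s r c : R -> T).

Lemma rev_lineK c : rev_line (rev_line c) = c.
Proof. by apply/funext => t; rewrite /rev_line opprK. Qed.

Lemma rev_flat c :
  bounds_flat_half_plane (rev_line c) -> bounds_flat_half_plane c.
Proof.
move=> [F [F1 F2]].
exists (fun p : euclidean_plane R => F (- p.1, p.2)); split=> [p q p0 q0|t /=].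
  rewrite F1//; apply: eqr_of_sqr; rewrite ?mdist_ge0//.
  by case: p {p0} => ? ?; case: q {q0} => ? ?; rewrite !plane_dist_sqr/=; ring.
by rewrite F2 /rev_line opprK.
Qed.

Lemma isomK (g : self_isometry T) x : isom_inv g (g x) = x.
Proof. exact: isom_funK. Qed.

(** c is an axis of a rank one isometry, k n the power of exponent n of the
    latter and l its translation length. *)
Definition rank_one_line c (k : nat -> self_isometry T) (l : R) :=
  [/\ is_line c, 0 < l, forall n t, k n (c t) = c (t + n%:R * l) &
      ~ bounds_flat_half_plane c].

Lemma rank_one_line_rev c k l : rank_one_line c k l ->
  rank_one_line (rev_line c) (fun n => isom_inv (k n)) l.
Proof.
move=> [hc l0 hk hf]; split=> //; [exact: rev_is_line| |by move/rev_flat].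
move=> n t; rewrite /rev_line -[in RHS](isomK (k n) (c _)) hk.
by congr (isom_inv _ (c _)); ring.
Qed.

(** On the axis, the Busemann functions of the rays k n \o s are those of s seen
    farther and farther towards the negative end. *)
Lemma buse_push c k l s r n t : rank_one_line c k l -> is_ray s -> is_ray r ->
  r 0 = c 0 -> asymp r (k n \o s) ->
  buse r (c t) = buse s (c (t - n%:R * l)) - buse s (c (- (n%:R * l))).
Proof.
move=> [hc l0 hk _] hs hr r0 ha; have hks := isom_is_ray (k n) hs.
have E v : buse (k n \o s) (c v) = buse s (c (v - n%:R * l)).
  by rewrite -[in RHS](buse_isom (k n)) hk subrK.
have := buse_shift cn geo (c t) hr hks ha; rewrite r0 !E sub0r; lra.
Qed.

Lemma rank_one_shift c k l t (z : R) : rank_one_line c k l ->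
  exists N, forall n, (N <= n)%N -> t - n%:R * l <= z /\ - (n%:R * l) <= z.
Proof.
move=> [_ l0 _ _]; pose M := (`|t| + `|z|) / l.
exists (Num.truncn M).+1 => n Nn.
have Mn : M < n%:R.
  by apply: (lt_le_trans (truncnS_gt M)); rewrite ler_nat.
have : `|t| + `|z| < n%:R * l by rewrite -ltr_pdivrMr.
have := ler_norm t; have := ler_norm (- z); rewrite normrN.
have := normr_ge0 t; lra.
Qed.

(** Along a rank one axis a Busemann function has extreme slope at the ends:
    pushing it forward by the translations makes it affine in the limit, and
    an affine one of intermediate slope would span a flat half plane. *)
Lemma end_slope c k l s m : rank_one_line c k l -> is_ray s ->
  -1 <= m <= 1 -> initial_slope (buse s \o c) m -> m = 1 \/ m = -1.
Proof.
move=> hck hs /andP[m1 m2] [hlow hup]; have [hc l0 hk hflat] := hck.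
have [->|m1'] := eqVneq m 1; first by left.
have [->|m2'] := eqVneq m (-1); first by right.
exfalso; apply: hflat.
have {}m1 : -1 < m by rewrite lt_neqAle eq_sym m2'.
have {}m2 : m < 1 by rewrite lt_neqAle m1'.
have /choice[tau htau] n :
    exists s', [/\ is_ray s', s' 0 = c 0 & asymp s' (k n \o s)].
  by apply: asymp_ray => //; exact: isom_is_ray.
have [||M|r [hr r0 hcl]] := @ray_cluster R T hprop tau (fun n => n%:R) (c 0).
- move=> n t u /andP[t0 _] /andP[u0 _].
  by have [h _ _] := htau n; exact: h.
- by move=> n; case: (htau n).
- exists (Num.truncn M).+1 => n Nn; apply/ltW/(lt_le_trans (truncnS_gt M)).
  by rewrite ler_nat.
apply: (flat_half_plane cn geo hprop hr hc m1 m2) => t.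
rewrite -{1}r0 buse_start// add0r.
apply: (@buse_limit R T cn tau) => //.
- by move=> n; case: (htau n).
- by move=> n; rewrite r0; case: (htau n).
- by move=> u e N u0 e0; have [n [? _ ?]] := hcl u e N u0 e0; exists n.
move=> e e0.
pose e' := e / (`|t| + 1).
have t1 : 0 < `|t| + 1 by have := normr_ge0 t; lra.
have e'0 : 0 < e' by rewrite /e' divr_gt0.
have e'e : e' * `|t| <= e.
  rewrite /e' mulrAC ler_pdivrMr//; have := normr_ge0 t; nra.
have [z hz] := hup e' e'0.
have [N hN] := rank_one_shift t z hck.
exists N => n /hN[z1 z2]; have [ht t0 ta] := htau n.
rewrite (buse_push t hck hs ht t0 ta).
have [tt|tt] := lerP 0 t.
  have k0 : - (n%:R * l) <= t - n%:R * l by lra.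
  have := hz _ _ k0 z1; have := hlow _ _ k0 => /=.
  rewrite ger0_norm// in e'e.
  by rewrite ler_norml => *; apply/andP; split; lra.
have k0 : t - n%:R * l <= - (n%:R * l) by lra.
have := hz _ _ k0 z2; have := hlow _ _ k0 => /=.
rewrite ltr0_norm// in e'e.
by rewrite ler_norml => *; apply/andP; split; lra.
Qed.

(** By convexity, initial slope 1 means slope at least 1 throughout: towards the
    negative end the Busemann function decreases at speed 1, as only its own ray
    allows. *)
Lemma slope_one_asymp c s : is_line c -> is_ray s ->
  initial_slope (buse s \o c) 1 -> asymp s (rev_line c).
Proof.
move=> hc hs [hlow _]; have hr := line_is_ray (rev_is_line hc).
have [r [hr' r0 ra]] := asymp_ray cn geo hprop (c 0) hs.
apply: asymp_trans (asymp_sym ra) _; apply: eq_asymp.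
apply: (buse_eq_ray cn hr' hr); first by rewrite r0 /rev_line oppr0.
move=> t t0; rewrite /rev_line.
have := buse_shift cn geo (c (- t)) hr' hs ra.
have := buse_shift cn geo (c 0) hr' hs ra.
have tn : - t <= 0 by lra.
have E0 : buse r (c 0) = 0 by rewrite -r0 buse_start.
by have := hlow _ _ tn => /=; rewrite E0; lra.
Qed.

(** A convex function on a half-line that is bounded above is nonincreasing. *)
Lemma buse_bounded_ray s r C : is_ray s -> is_ray r ->
  (forall t, 0 <= t -> buse s (r t) <= C) ->
  forall t, 0 <= t -> buse s (r t) <= buse s (r 0).
Proof.
move=> hs hr hC t t0; apply/ler_addgt0Pr => e e0.
pose A := `|C| + `|buse s (r 0)|.
have A0 : 0 <= A by rewrite addr_ge0.
pose u := Num.max (t + 1) (t * A / e).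
have [u1 u2] : t + 1 <= u /\ t * A / e <= u by rewrite !le_max !lexx orbT.
have u0 : 0 < u by lra.
have tu : t <= u by lra.
have l01 : 0 <= t / u <= 1 by rewrite divr_ge0 ?(ltW u0)//= ler_pdivrMr// mul1r.
have := @buse_convex R T cn s (r 0) (r u) (r t) _ hs l01.
rewrite !(ray_dist hr) ?lexx ?t0 ?(ltW u0)// !subr0 mulrBl mul1r.
rewrite divfK ?gt_eqF// => /(_ erefl erefl) h; apply: (le_trans h).
have : t / u * (buse s (r u) - buse s (r 0)) <= t / u * A.
  case/andP: l01 => k0 _; rewrite ler_wpM2l// /A.
  have := hC u (ltW u0); have := ler_norm C; have := ler_norm (- buse s (r 0)).
  by rewrite normrN; lra.
have : t / u * A <= e.
  by rewrite mulrAC ler_pdivrMr// [leRHS]mulrC -ler_pdivrMr.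
by rewrite mulrBl mul1r; lra.
Qed.

(** If s has slope -1 at the negative end of the axis, the rays from c 0 in the
    classes of its translates k n \o s converge to the positive half of the
    axis, so that an upper bound for the Busemann function of r along all the
    translates passes to this half. *)
Lemma slope_minus_one_push c k l s r : rank_one_line c k l -> is_ray s ->
  is_ray r -> initial_slope (buse s \o c) (-1) ->
  (forall n, exists C, forall t, 0 <= t -> buse r (k n (s t)) <= C) ->
  forall t, 0 <= t -> buse r (c t) <= buse r (c 0).
Proof.
move=> hck hs hr [_ hup] hC t t0; have [hc l0 hk hflat] := hck.
apply/ler_addgt0Pr => e e0.
have t1 : 0 < t + 1 by lra.
pose e' := (e / (t + 1)) ^+ 2 / 2.
have e'0 : 0 < e' by rewrite divr_gt0 ?exprn_gt0 ?divr_gt0.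
have [z hz] := hup e' e'0.
have [N hN] := rank_one_shift t z hck; have [z1 z2] := hN N (leqnn N).
have [q [hq q0 qa]] := asymp_ray cn geo hprop (c 0) (isom_is_ray (k N) hs).
have k0 : - (N%:R * l) <= t - N%:R * l by lra.
have := hz _ _ k0 z1 => /=; rewrite -(buse_push t hck hs hq q0 qa) => k1.
(* The ray q from c 0 is close to c at time t, by the law of cosines. *)
have k2 : mdist (c t) (q t) <= e.
  have := buse_quad cn (c t) hq t0; rewrite q0 hc subr0 ger0_norm// => k2.
  have k3 : mdist (c t) (q t) ^+ 2 <= 2 * e' * t ^+ 2.
    have : t * buse q (c t) <= t * ((-1 + e') * t) by rewrite ler_wpM2l//; lra.
    nra.
  apply: ler_of_sqr; first exact: ltW.
  apply: (le_trans k3).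
  have -> : 2 * e' * t ^+ 2 = (e / (t + 1) * t) ^+ 2.
    by rewrite /e' exprMn; field; rewrite gt_eqF.
  have : 0 <= e / (t + 1) * t <= e.
    rewrite !mulr_ge0 ?invr_ge0 ?(ltW e0) ?(ltW t1)//= mulrAC ler_pdivrMr//.
    by rewrite ler_pM2l//; lra.
  by move=> /andP[? ?]; nra.
have [C hC'] := hC N; have [C' hC''] := qa.
have hb v : 0 <= v -> buse r (q v) <= C + C'.
  move=> v0; have := hC' v v0; have := hC'' v v0 => /=.
  by have := buse_lip (q v) (k N (s v)) hr; lra.
have := buse_bounded_ray hr hq hb t0; rewrite q0.
have := buse_lip (c t) (q t) hr; lra.
Qed.

(** A convex function that is bounded above on a line is constant, whereas
    Busemann functions have slope 1 or -1 at the ends of a rank one axis. *)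
Lemma buse_axis_unbounded c k l r : rank_one_line c k l -> is_ray r ->
  ~ (forall t, buse r (c t) <= buse r (c 0)).
Proof.
move=> hck hr hb; have [hc _ _ _] := hck.
have [m [m1 hm]] := buse_line_slope cn hr hc.
have [mE|mE] := end_slope hck hr m1 hm; rewrite mE in hm; case: hm => h1 h2.
  by have := h1 0 1 ltac:(lra); have := hb 1 => /=; lra.
have [z hz] := h2 (1 / 2) ltac:(lra).
pose L := 2 * (buse r (c 0) - buse r (c z) + 1).
have L0 : 0 < L by rewrite /L; have := hb z; lra.
have := hz (z - L) z ltac:(lra) (lexx z); have := hb (z - L) => /=.
by rewrite /L in L0 *; lra.
Qed.

(** If s pointed to neither end of the axis, the rays from c 0 towards its
    translates would converge to both halves of the axis.  The whole axis would
    then lie in a horoball centred at the class of r. *)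
Lemma horoball_rays c k l s r : rank_one_line c k l -> is_ray s -> is_ray r ->
  (forall n, exists C, forall t, 0 <= t -> buse r (k n (s t)) <= C) ->
  (forall n, exists C, forall t, 0 <= t ->
     buse r (isom_inv (k n) (s t)) <= C) ->
  asymp s c \/ asymp s (rev_line c).
Proof.
move=> hck hs hr h1 h2; have hck' := rank_one_line_rev hck.
have [hc _ _ _] := hck; have [hc' _ _ _] := hck'.
have [m [m1 hm]] := buse_line_slope cn hs hc.
have [m' [m1' hm']] := buse_line_slope cn hs hc'.
have [E|E] := end_slope hck hs m1 hm; rewrite E in hm.
  by right; exact: slope_one_asymp.
have [E'|E'] := end_slope hck' hs m1' hm'; rewrite E' in hm'.
  by left; rewrite -[c]rev_lineK; exact: slope_one_asymp.
exfalso; apply: (buse_axis_unbounded hck hr) => t.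
have [t0|t0] := leP 0 t; first exact: (slope_minus_one_push hck hs hr hm h1).
have := @slope_minus_one_push _ _ _ _ _ hck' hs hr hm' h2 (- t).
by rewrite /rev_line opprK oppr0; apply; lra.
Qed.

(** The Busemann function at a point fixed by g changes by a constant under each
    step L along the axis, so that its slopes at the two ends of the axis cannot
    be of opposite signs. *)
Lemma fixed_is_end c k l (g : self_isometry T) (L : R) r :
  rank_one_line c k l -> 0 < L -> (forall t, g (c t) = c (t + L)) ->
  is_ray r -> asymp (g \o r) r -> asymp r c \/ asymp r (rev_line c).
Proof.
move=> hck L0 hg hr ha; have hck' := rank_one_line_rev hck.
have [hc _ _ _] := hck; have [hc' _ _ _] := hck'.
have [m [m1 hm]] := buse_line_slope cn hr hc.
have [m' [m1' hm']] := buse_line_slope cn hr hc'.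
have [E|E] := end_slope hck hr m1 hm; rewrite E in hm.
  by right; exact: slope_one_asymp.
have [E'|E'] := end_slope hck' hr m1' hm'; rewrite E' in hm'.
  by left; rewrite -[c]rev_lineK; exact: slope_one_asymp.
have hgr := isom_is_ray g hr.
pose K := buse (g \o r) (r 0).
have hK t : buse r (c (t - L)) = buse r (c t) + K.
  rewrite -(buse_shift cn geo (c t) hr hgr (asymp_sym ha)).
  by rewrite -(buse_isom g r) hg subrK.
have [_ /(_ (1 / 2) ltac:(lra))[z hz]] := hm.
have [_ /(_ (1 / 2) ltac:(lra))[z' hz']] := hm'.
have := hz (z - L) z ltac:(lra) (lexx z) => /=.
have := hz' (z' - L) z' ltac:(lra) (lexx z') => /=; rewrite /rev_line.
have := hK z; have := hK (- z' + L); rewrite addrK.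
have -> : - (z' - L) = - z' + L by ring.
by lra.
Qed.

End rank_one.

(** * Independent rank one isometries and the growth condition *)

Section powers.
Context (R : realType) (T1 T2 : metricType R).
Implicit Types g h : (self_isometry T1 * self_isometry T2)%type.

Lemma mul_isomE (T : metricType R) (f f' : self_isometry T) (x : T) :
  (f * f')%g x = f (f' x).
Proof. by []. Qed.

Lemma fst_expg g n : ((g ^+ n)%g).1 = (g.1 ^+ n)%g.
Proof. by elim: n => // n IH; rewrite !expgS /= IH. Qed.

Lemma prod_funM g h (x : l2prod T1 T2) :
  prod_fun (g * h)%g x = prod_fun g (prod_fun h x).
Proof. by []. Qed.

End powers.

Section boundary_points.
Context (R : realType) (T : metricType R).
Hypotheses (cn : cn_ineq T) (geo : geodesic_space T) (hprop : proper_space T).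
Implicit Types (g h : self_isometry T) (c s r : R -> T).

Lemma ray_classE (s s' : ray T) : (ray_class s = ray_class s') <-> asymp s s'.
Proof.
split=> [/eqmodP/asboolP//|h].
by apply/eqmodP/asboolP.
Qed.

Lemma ray_of_asymp (xi : boundary T) (s : ray T) : ray_class s = xi ->
  asymp (ray_of xi) s.
Proof.
by move=> <-; apply/ray_classE; rewrite /ray_class /ray_of reprK.
Qed.

Lemma rank_one_axis_line g c : rank_one_axis g c ->
  exists l, rank_one_line c (fun n => (g ^+ n)%g) l.
Proof.
move=> [hc [l l0 hl] hf]; exists l; split=> // n.
elim: n => [|n IH] t; first by rewrite mul0r addr0.
by rewrite expgS mul_isomE IH hl; congr c; rewrite -natr1; ring.
Qed.

Definition end_of c s := asymp s c \/ asymp s (rev_line c).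

Lemma fixed_endsP g c s : rank_one_axis g c -> is_ray s -> end_of c s ->
  forall s' : ray T, asymp s' s -> fixed_ends g (ray_class s').
Proof.
move=> hg hs he s' hs'; exists c => //; have [hc _ _] := hg.
have [hs1|hs1] := he; have := asymp_trans hs' hs1 => hs2.
  exists (Ray (line_is_ray hc)); split; last by left.
  by apply/ray_classE; exact: asymp_sym.
exists (Ray (line_is_ray (rev_is_line hc))); split; last by right.
by apply/ray_classE; exact: asymp_sym.
Qed.

Lemma independent_ends g h c c' s : independent_rank_one g h ->
  rank_one_axis g c -> rank_one_axis h c' -> is_ray s ->
  end_of c s -> end_of c' s -> False.
Proof.
move=> [_ _ hd] hg hh hs h1 h2.
have : (fixed_ends g `&` fixed_ends h) (ray_class (Ray hs)).
  by split; [apply: (fixed_endsP hg hs)|apply: (fixed_endsP hh hs)] => //;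
    exact: eq_asymp.
by rewrite hd.
Qed.

(** A boundary point fixed by a power of g and by a power of h would be an end
    of an axis of each. *)
Lemma independent_no_fixed g h s m n : independent_rank_one g h -> is_ray s ->
  (0 < m)%N -> (0 < n)%N -> asymp ((g ^+ m)%g \o s) s ->
  asymp ((h ^+ n)%g \o s) s -> False.
Proof.
have fix_end f c k : rank_one_axis f c -> is_ray s -> (0 < k)%N ->
    asymp ((f ^+ k)%g \o s) s -> end_of c s.
  move=> hf hs k0 ha; have [l hl] := rank_one_axis_line hf.
  have [_ l0 hk _] := hl.
  by apply: (fixed_is_end cn geo hprop hl _ (hk k) hs ha); rewrite mulr_gt0 ?ltr0n.
move=> hi hs m0 n0 hm hn; have [[c hc] [c' hc'] _] := hi.
apply: (independent_ends hi hc hc' hs).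
  exact: fix_end hc hs m0 hm.
exact: fix_end hc' hs n0 hn.
Qed.

(** If the Busemann function of s were sublinear along all the translates of the
    sequence by powers of g and h, all the corresponding translates of a limit
    ray of the sequence would stay in horoballs.  The limit ray would then point
    to an end of an axis of g and to an end of an axis of h. *)
Lemma positive_escape g h (x : nat -> T) p s (P : self_isometry T -> Prop) :
  independent_rank_one g h -> is_ray s -> diverges (fun n => mdist p (x n)) ->
  (forall n, P (g ^+ n)%g) -> (forall n, P (isom_inv (g ^+ n)%g)) ->
  (forall n, P (h ^+ n)%g) -> (forall n, P (isom_inv (h ^+ n)%g)) ->
  ~ (forall k, P k -> forall e, 0 < e -> exists N, forall n, (N <= n)%N ->
       buse s (k (x n)) <= e * mdist p (x n)).
Proof.
move=> hi hs hx hg1 hg2 hh1 hh2 hP.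
have [r [hr r0 hle]] := limit_ray_le cn geo hprop hx.
have bd k : P k -> exists C, forall t, 0 <= t -> buse s (k (r t)) <= C.
  move=> Pk; exists (buse s (k p)) => t t0.
  have kE y : buse (isom_inv k \o s) y = buse s (k y).
    by rewrite -[in RHS](buse_isom (isom_inv k)) isomK.
  rewrite -!kE; apply: hle => //; first exact: isom_is_ray.
  move=> e e0; have [N hN] := hP k Pk e e0; exists N => n Nn.
  by rewrite kE hN.
have ends f c : rank_one_axis f c -> (forall n, P (f ^+ n)%g) ->
    (forall n, P (isom_inv (f ^+ n)%g)) -> end_of c r.
  move=> hf h1 h2; have [l hl] := rank_one_axis_line hf.
  by apply: (horoball_rays cn geo hprop hl hr hs) => n; apply: bd.
have [[c hc] [c' hc'] _] := hi.
by apply: (independent_ends hi hc hc' hr);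
  [exact: ends hc _ _|exact: ends hc' _ _].
Qed.

(** The escape of some translate bounds the coefficient b of a Busemann function
    from below as soon as the error E is sublinear in the distance. *)
Lemma slope_ge0 g h (x : nat -> T) p s (P : self_isometry T -> Prop)
    (E : nat -> R) b :
  independent_rank_one g h -> is_ray s -> diverges (fun n => mdist p (x n)) ->
  (forall n, P (g ^+ n)%g) -> (forall n, P (isom_inv (g ^+ n)%g)) ->
  (forall n, P (h ^+ n)%g) -> (forall n, P (isom_inv (h ^+ n)%g)) ->
  (forall n, 0 <= E n /\ E n * n.+1%:R <= mdist p (x n)) ->
  (forall k, P k -> exists K A, forall n,
     - b * buse s (k (x n)) <= K + A * E n) -> 0 <= b.
Proof.
move=> hi hs hx hg1 hg2 hh1 hh2 hE hP; rewrite leNgt; apply/negP => b0.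
apply: (positive_escape hi hs hx hg1 hg2 hh1 hh2) => k Pk e e0.
have [K [A hK]] := hP k Pk.
pose e' := - b * e / 2.
have e'0 : 0 < e' by rewrite /e' divr_gt0// mulr_gt0// oppr_gt0.
have [N hN] := hx (K / e').
exists (maxn N (Num.truncn (`|A| / e')).+1) => n; rewrite geq_max.
move=> /andP[/hN K1 An]; set d := mdist p (x n) in K1 *.
have nA : `|A| / e' < n.+1%:R.
  apply: (lt_le_trans (truncnS_gt _)); rewrite ler_nat.
  exact: leq_trans An (leqnSn n).
have [E0 En] := hE n; have := hK n; have b0' : 0 < - b by rewrite oppr_gt0.
move=> k1; rewrite -(ler_pM2l b0'); apply: (le_trans k1).
have k2 : K <= e' * d by rewrite mulrC -ler_pdivrMr.
have k3 : A * E n <= e' * d.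
  apply: (@le_trans _ _ (e' * n.+1%:R * E n)).
    rewrite ler_wpM2r//; apply: (le_trans (ler_norm A)).
    by rewrite mulrC -ler_pdivrMr// ltW.
  by rewrite -mulrA ler_wpM2l ?(ltW e'0)// mulrC.
have e2 : 2 * e' = - b * e by rewrite /e'; field.
by rewrite mulrA -e2; lra.
Qed.

End boundary_points.

Section growth.
Context (R : realType) (X1 X2 : metricType R).
Variables (G : set (self_isometry X1 * self_isometry X2)) (o : l2prod X1 X2).

(** An orbit that is bounded near the direction th has empty annuli there, and
    then growth rate -oo, as log 0 = -oo. *)
Lemma growth_unbounded th e N : (0 <= growth G o th)%E -> 0 < e ->
  exists g, [/\ G g, N%:R <= mdist o (prod_isom g o) & `|slope o g - th| <= e].
Proof.
move=> hg e0; apply: contrapT => hno.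
suff h : growth G o th = -oo%E by rewrite h in hg.
have hempty e' n : e' <= e -> (N < n)%N -> slope_annulus G o e' th n = set0.
  move=> e'e Nn; apply/seteqP; split=> // g [Gg _ /andP[h1 _] h2].
  apply: hno; exists g; split=> //; last exact: le_trans e'e.
  by apply: le_trans h1; rewrite lerBrDr natr1 ler_nat.
have hge e' : e' <= e -> growth_eps G o e' th = -oo%E.
  move=> e'e; rewrite /growth_eps; apply: (cvgNy_limn_einf_sup _).2.
  apply/cvgeNyPle => M; exists N.+1 => // n /= Nn.
  rewrite hempty// /counting asboolT// fset_set0 /= lexx.
  by rewrite mulNyr gtr0_sg ?invr_gt0 ?ltr0n ?(leq_trans _ Nn)// mul1e leNye.
rewrite /growth limf_einfE; apply/eqP; rewrite -leeNy_eq.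
apply: ge_ereal_sup => _ [V hV <-].
have : \forall e' \near 0^'+, V e' /\ (e' : R) <= e.
  near=> e'; split; first by near: e'.
  by near: e'; exact: nbhs_right_le.
move=> /filter_ex[e' [Ve' e'e]].
by apply: ereal_inf_le; exists -oo%E => //; exists e'; rewrite ?hge.
Unshelve. all: by end_near. Qed.

(** At slopes at most atan (1 / n.+1), the second displacement is at most
    1 / n.+1 times the first. *)
Lemma growth_horizontal n : (0 <= growth G o 0)%E ->
  exists g, [/\ G g, n%:R <= mdist o.1 (g.1 o.1) &
    mdist o.2 (g.2 o.2) * n.+1%:R <= mdist o.1 (g.1 o.1)].
Proof.
move=> hg; pose k : R := n.+1%:R^-1.
have k0 : 0 < k by rewrite invr_gt0.
have a0 : 0 < atan k by rewrite -(atan0 R) lt_atan.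
have [g [Gg h1 h2]] := growth_unbounded (2 * n)%N hg a0.
move: h2; rewrite subr0 /slope; case: ifPn => [_|d0].
  rewrite ger0_norm ?divr_ge0 ?pi_ge0// => h.
  by have := atan_ltpi2 k; rewrite ltNge h.
have {}d0 : 0 < mdist o.1 (g.1 o.1) by rewrite lt_neqAle eq_sym d0 mdist_ge0.
move=> /(le_trans (ler_norm _)) h.
have : mdist o.2 (g.2 o.2) / mdist o.1 (g.1 o.1) <= k.
  by rewrite leNgt; apply/negP => /lt_atan; rewrite ltNge h.
rewrite ler_pdivrMr// /k mulrC ler_pdivlMr ?ltr0n// => h2.
exists g; split=> //.
have h3 : mdist o.2 (g.2 o.2) <= mdist o.1 (g.1 o.1).
  apply: le_trans h2; rewrite ler_peMr ?mdist_ge0// ler1n//.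
have : mdist o (prod_isom g o) <= 2 * mdist o.1 (g.1 o.1).
  apply: ler_of_sqr; first by rewrite mulr_ge0 ?mdist_ge0.
  rewrite l2dist_sqr /=; have := mdist_ge0 o.2 (g.2 o.2); nra.
by move: h1; rewrite natrM; lra.
Qed.

Lemma growth_vertical n : (0 <= growth G o (pi / 2))%E ->
  exists g, [/\ G g, n%:R <= mdist o.2 (g.2 o.2) &
    mdist o.1 (g.1 o.1) * n.+1%:R <= mdist o.2 (g.2 o.2)].
Proof.
move=> hg; pose k : R := n.+1%:R.
have a0 : 0 < pi / 2 - atan k by rewrite subr_gt0 atan_ltpi2.
have [g [Gg h1 h2]] := growth_unbounded (2 * n)%N hg a0.
have h3 : mdist o.1 (g.1 o.1) * k <= mdist o.2 (g.2 o.2).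
  move: h2; rewrite /slope; case: ifPn => [/eqP -> _|d0].
    by rewrite mul0r mdist_ge0.
  have {}d0 : 0 < mdist o.1 (g.1 o.1) by rewrite lt_neqAle eq_sym d0 mdist_ge0.
  rewrite distrC => /(le_trans (ler_norm _)) h.
  rewrite mulrC -ler_pdivlMr// leNgt; apply/negP => /lt_atan.
  by rewrite ltNge; apply/negP; rewrite negbK; lra.
exists g; split=> //.
have h4 : mdist o.1 (g.1 o.1) <= mdist o.2 (g.2 o.2).
  apply: le_trans h3; rewrite ler_peMr ?mdist_ge0// ler1n//.
have : mdist o (prod_isom g o) <= 2 * mdist o.2 (g.2 o.2).
  apply: ler_of_sqr; first by rewrite mulr_ge0 ?mdist_ge0.
  rewrite l2dist_sqr /=; have := mdist_ge0 o.1 (g.1 o.1); nra.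
by move: h1; rewrite natrM; lra.
Qed.

End growth.

(** * The cone topology and radial limit points *)

Section cone_topology.
Context (R : realType) (T : metricType R).

Lemma cone_nbhd_open (c : ray T) r e : 0 < r -> 0 < e ->
  open (cone_nbhd c r e : set (bordification T)).
Proof.
move=> r0 e0; set U := cone_nbhd c r e.
have DU : cone_subbase U by right; exists c, r, e.
exists [set U]; last by rewrite bigcup_set1.
move=> _ ->; exists [fset U]%fset.
  by move=> V /fset1P ->; rewrite inE.
by rewrite set_fset1 bigcap_set1.
Qed.

(** Points of the boundary are closed: seen from the starting point of a ray
    c, another boundary point is the class of at most one ray, and this one is
    at distance at least 1 from c at some time. *)
Lemma boundary_closed1 (cn : cn_ineq T) (eta : boundary T) : closed [set eta].
Proof.
rewrite -[X in closed X]setCK; apply: open_closedC.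
rewrite openE => zeta /= hz; pose c := ray_of zeta.
have hc : ray_class c = zeta by rewrite /ray_class /c /ray_of reprK.
have [r [r0 hr]] : exists r, 0 < r /\ ~ cone_nbhd c r 1 (inr eta).
  apply: contrapT => hno; apply: hz.
  have hcone r : 0 < r -> cone_nbhd c r 1 (inr eta).
    by move=> r0; apply: contrapT => h; apply: hno; exists r.
  have [d [dE d0 _]] := hcone 1 ltr01.
  rewrite -hc -dE; apply/esym/ray_classE; exists 1 => t.
  rewrite le_eqVlt => /orP[/eqP <-|t0]; first by rewrite d0 mdistxx.
  have [d' [d'E d'0 d't]] := hcone t t0.
  have dd' : asymp d d' by apply/ray_classE; rewrite dE d'E.
  rewrite (ray_unique cn (rayP d) (rayP d') _ dd') ?(ltW t0)//.
    exact: ltW.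
  by rewrite d0.
rewrite /interior /= nbhsE /=.
exists ((@inr T (boundary T)) @^-1` cone_nbhd c r 1).
  split; last by exists c; rewrite mdistxx.
  by exists (cone_nbhd c r 1) => //; exact: cone_nbhd_open.
by move=> xi /= h1 h2; apply: hr; rewrite -h2.
Qed.

Lemma measurable_boundary1 (cn : cn_ineq T) (xi0 eta : boundary T) :
  measurable ([set eta] : set (borel_boundary xi0)).
Proof.
rewrite -[X in measurable X]setCK; apply: measurableC.
have h := closed_openC (boundary_closed1 cn (eta:=eta)).
by apply: sub_sigma_algebra; exact: h.
Qed.

Lemma ray_class_ray_of (xi : boundary T) : ray_class (ray_of xi) = xi.
Proof. by rewrite /ray_class /ray_of reprK. Qed.

Lemma boundary_actE (g : self_isometry T) (s : ray T) :
  boundary_act g (ray_class s) = ray_class (isom_ray g s).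
Proof. by apply/ray_classE; apply: asymp_isom; exact: ray_of_asymp. Qed.

Lemma boundary_act_preimage (g : self_isometry T) (eta : boundary T) :
  boundary_act g @^-1` [set eta] = [set boundary_act (isom_inv g) eta].
Proof.
rewrite -(ray_class_ray_of eta); set s := ray_of eta; rewrite boundary_actE.
apply/seteqP; split => xi /=; rewrite -(ray_class_ray_of xi) !boundary_actE.
  move/ray_classE => /(asymp_isom (isom_inv g)) h; apply/ray_classE.
  by apply: asymp_trans h; apply: eq_asymp => t _ /=; rewrite isom_funK.
move/ray_classE => /(asymp_isom g) h; apply/ray_classE.
by apply: asymp_trans h _; apply: eq_asymp => t _ /=; rewrite isom_inv_funK.
Qed.

(** In a bounded neighbourhood of a ray towards xi, the Busemann function at xi
    is the distance up to a constant. *)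
Lemma close_busemann (u : nat -> T) (xi : boundary T) y :
  close_to_ray u xi ->
  exists K, forall n, mdist y (u n) - K <= busemann xi y (u n).
Proof.
move=> [s [C [hs hC]]]; have [C' hC'] := ray_of_asymp hs.
pose r := ray_of xi; have hr := rayP r.
exists (C + C' + mdist y (r 0) + (C + C') - buse r y) => n.
have [t t0 ht] := hC n; rewrite busemannE -/r.
have := hC' t t0; rewrite -/r => h.
have := buse_le (r t) hr t0; rewrite mdistxx.
have := buse_lip (u n) (r t) hr.
have := metric_triangle (u n) (s t) (r t); rewrite (metric_sym (s t)).
have := metric_triangle y (r 0) (u n); have := metric_triangle (r 0) (r t) (u n).
rewrite (ray_dist hr) ?lexx// (metric_sym (r t) (u n)); lra.
Qed.

(** Rays run through at constant speeds p and p' can only stay close to each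
    other if the speeds agree. *)
Lemma asymp_scale (a a' : R -> T) (p p' C : R) : is_ray a -> is_ray a' ->
  0 < p -> 0 <= p' ->
  (forall t, 0 <= t -> mdist (a (t * p)) (a' (t * p')) <= C) -> asymp a a'.
Proof.
move=> ha ha' p0 p'0 h.
have pp : p = p'.
  apply/eqP; rewrite -subr_eq0 -normr_eq0; apply/negPn/negP => hn.
  have n0 : 0 < `|p - p'| by rewrite lt_neqAle eq_sym hn normr_ge0.
  pose t := (C + mdist (a 0) (a' 0) + 1) / `|p - p'|.
  have C0 : 0 <= C by exact: le_trans (mdist_ge0 _ _) (h 0 (lexx 0)).
  have tE : t * `|p - p'| = C + mdist (a 0) (a' 0) + 1.
    by rewrite /t divfK// gt_eqF.
  have t0 : 0 <= t.
    by rewrite divr_ge0//; have := mdist_ge0 (a 0) (a' 0); lra.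
  have tp : 0 <= t * p by rewrite mulr_ge0// ltW.
  have tp' : 0 <= t * p' by rewrite mulr_ge0.
  have h1 : mdist (a 0) (a (t * p)) = t * p.
    by rewrite (ray_dist ha) ?lexx// subr0.
  have h2 : mdist (a' 0) (a' (t * p')) = t * p'.
    by rewrite (ray_dist ha') ?lexx// subr0.
  have := h t t0; have := metric_triangle (a 0) (a' 0) (a' (t * p')).
  have := metric_triangle (a 0) (a' (t * p')) (a (t * p)).
  have := metric_triangle (a' 0) (a 0) (a (t * p)).
  have := metric_triangle (a' 0) (a (t * p)) (a' (t * p')).
  rewrite h1 h2 (metric_sym (a' 0) (a 0)) (metric_sym (a' (t * p'))).
  have : t * `|p - p'| <= `|t * p - t * p'|.
    by rewrite -mulrBr normrM ger0_norm.
  by rewrite tE => k; have := ler_norm (t * p - t * p'); move: k;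
    case: (lerP 0 (t * p - t * p')) => k0;
    [rewrite ger0_norm//|rewrite ltr0_norm//]; lra.
exists C => t t0; have := h (t / p); rewrite -pp divfK ?gt_eqF//; apply.
by rewrite divr_ge0// ltW.
Qed.

Lemma ray_unbounded (a : R -> T) x p C : is_ray a -> 0 < p ->
  ~ (forall t, 0 <= t -> mdist (a (t * p)) x <= C).
Proof.
move=> ha p0 h; pose t := (C + mdist (a 0) x + 1) / p.
have C0 : 0 <= C by exact: le_trans (mdist_ge0 _ _) (h 0 (lexx 0)).
have t0 : 0 <= t by rewrite divr_ge0 ?(ltW p0)//; have := mdist_ge0 (a 0) x; lra.
have tp : t * p = C + mdist (a 0) x + 1 by rewrite /t divfK// gt_eqF.
have at0 : mdist (a 0) (a (t * p)) = t * p.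
  by rewrite (ray_dist ha) ?subr0// lexx mulr_ge0// ltW.
have := h t t0; have := metric_triangle (a 0) x (a (t * p)).
by rewrite at0 tp (metric_sym x); lra.
Qed.

End cone_topology.

Section radial.
Context (R : realType) (X1 X2 : metricType R).
Notation X := (l2prod X1 X2).

Lemma l2dist_fst (x y : X) : mdist x.1 y.1 <= mdist x y.
Proof.
by apply: ler_of_sqr; rewrite ?mdist_ge0// l2dist_sqr lerDl sqr_ge0.
Qed.

Lemma l2dist_snd (x y : X) : mdist x.2 y.2 <= mdist x y.
Proof.
by apply: ler_of_sqr; rewrite ?mdist_ge0// l2dist_sqr lerDr sqr_ge0.
Qed.

Lemma open_quadrant (th : R) : 0 < th < pi / 2 -> 0 < cos th /\ 0 < sin th.
Proof.
move=> /andP[t0 t1]; have p0 := pi_gt0 R; split.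
  by apply: cos_gt0_pihalf; apply/andP; split; lra.
by apply: sin_gt0_pi; apply/andP; split; lra.
Qed.

Lemma regular_point_uniq th th' xi1 xi2 xi1' xi2' (eta : boundary X) :
  0 < th < pi / 2 -> 0 < th' < pi / 2 ->
  regular_point th xi1 xi2 eta -> regular_point th' xi1' xi2' eta ->
  xi1 = xi1' /\ xi2 = xi2'.
Proof.
move=> /open_quadrant[c0 s0] /open_quadrant[c0' s0'].
move=> [a1 [a2 [a [<- <- <- ha]]]] [b1 [b2 [b [<- <- ba hb]]]].
have /ray_classE [C hC] := ba; split; apply/ray_classE.
  apply: (@asymp_scale _ _ _ _ (cos th) (cos th') C (rayP a1) (rayP b1)) => //.
    exact: ltW.
  move=> t t0; have := hC t t0; rewrite ha// hb// metric_sym.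
  exact: le_trans (l2dist_fst _ _).
apply: (@asymp_scale _ _ _ _ (sin th) (sin th') C (rayP a2) (rayP b2)) => //.
  exact: ltW.
move=> t t0; have := hC t t0; rewrite ha// hb// metric_sym.
exact: le_trans (l2dist_snd _ _).
Qed.

Lemma regular_not_singular1 th xi1 xi2 xi1' (eta : boundary X) :
  0 < th < pi / 2 ->
  regular_point th xi1 xi2 eta -> ~ singular_point1 xi1' eta.
Proof.
move=> /open_quadrant[c0 s0] [a1 [a2 [a [_ _ <- ha]]]].
move=> [b1 [x2 [b [_ /ray_classE [C hC] hb]]]].
apply: (@ray_unbounded _ _ a2 x2 _ C (rayP a2) s0) => t t0.
have := hC t t0; rewrite ha// hb// metric_sym.
exact: le_trans (l2dist_snd _ _).
Qed.

Lemma regular_not_singular2 th xi1 xi2 xi2' (eta : boundary X) :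
  0 < th < pi / 2 ->
  regular_point th xi1 xi2 eta -> ~ singular_point2 xi2' eta.
Proof.
move=> /open_quadrant[c0 s0] [a1 [a2 [a [_ _ <- ha]]]].
move=> [b2 [x1 [b [_ /ray_classE [C hC] hb]]]].
apply: (@ray_unbounded _ _ a1 x1 _ C (rayP a1) c0) => t t0.
have := hC t t0; rewrite ha// hb// metric_sym.
exact: le_trans (l2dist_fst _ _).
Qed.

(** The geodesics from a 0 to the points x n pass, at time r, within distance 1
    of a r, whose components are at distances r * cos th and r * sin th from
    those of a 0; and distances grow along both components of a geodesic. *)
Lemma regular_cvg_diverges th xi1 xi2 (eta : boundary X)
    (x : nat -> X) (o : X) :
  0 < th < pi / 2 -> regular_point th xi1 xi2 eta ->
  (inl (x n) : bordification X) @[n --> \oo] --> (inr eta : bordification X) ->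
  forall M, exists n, M <= mdist o.1 (x n).1 /\ M <= mdist o.2 (x n).2.
Proof.
move=> hth [a1 [a2 [a [_ _ aE ha]]]] hx M.
have [c0 s0] := open_quadrant hth.
pose K := `|M| + 1 + mdist o (a 0).
have K0 : 0 < K by have := mdist_ge0 o (a 0); have := normr_ge0 M; rewrite /K; lra.
pose r := K / cos th + K / sin th.
have rc : K <= r * cos th.
  by rewrite /r mulrDl divfK ?gt_eqF// lerDl mulr_ge0 ?divr_ge0 ?ltW.
have rs : K <= r * sin th.
  by rewrite /r mulrDl divfK ?gt_eqF// lerDr mulr_ge0 ?divr_ge0 ?ltW.
have r0 : 0 < r by rewrite addr_gt0 ?divr_gt0.
have hU : nbhs (inr eta : bordification X) (cone_nbhd a r 1).
  apply: open_nbhs_nbhs; split; first exact: cone_nbhd_open.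
  by exists a; rewrite mdistxx.
have [n [rn [d [l [hd hdr]]]]] := @filter_ex nat \oo _ _ (hx _ hU).
exists n; have lE := geodesic_length hd; rewrite lE in rn.
have l0 : 0 < l by lra.
have l01 : 0 <= r / l <= 1.
  by rewrite divr_ge0 ?(ltW r0) ?(ltW l0)//= ler_pdivrMr// mul1r ltW.
have [g1 g2] := geodesic_ratio hd l01.
rewrite divfK ?gt_eqF// in g1 g2.
have [] := @l2_ratio R X1 X2 (a 0) (x n) (d r) (r / l) l01.
- by rewrite g1 lE divfK// gt_eqF.
- by rewrite g2 lE.
move=> [e1 _] [e2 _]; have [k1 k2] := andP l01.
have ar := ha r (ltW r0); have a0 := ha 0 (lexx 0); rewrite !mul0r in a0.
have f1 : r * cos th <= mdist (a 0).1 (d r).1 + 1.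
  have := l2dist_fst (d r) (a r); have := metric_triangle (a 0).1 (d r).1 (a r).1.
  have : mdist (a 0).1 (a r).1 = r * cos th.
    by rewrite ar a0 /= (ray_dist (rayP a1)) ?lexx ?mulr_ge0 ?ltW// subr0.
  by lra.
have f2 : r * sin th <= mdist (a 0).2 (d r).2 + 1.
  have := l2dist_snd (d r) (a r); have := metric_triangle (a 0).2 (d r).2 (a r).2.
  have : mdist (a 0).2 (a r).2 = r * sin th.
    by rewrite ar a0 /= (ray_dist (rayP a2)) ?lexx ?mulr_ge0 ?ltW// subr0.
  by lra.
have nM := ler_norm M.
split.
  have := metric_triangle (a 0).1 o.1 (x n).1; have := l2dist_fst o (a 0).
  rewrite (metric_sym (a 0).1 o.1); have := mdist_ge0 (a 0).1 (x n).1.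
  by rewrite /K in rc; nra.
have := metric_triangle (a 0).2 o.2 (x n).2; have := l2dist_snd o (a 0).
rewrite (metric_sym (a 0).2 o.2); have := mdist_ge0 (a 0).2 (x n).2.
by rewrite /K in rs; nra.
Qed.

(** Only the first kind of radial limit points is regular. *)
Lemma regular_radial (G : set (self_isometry X1 * self_isometry X2)) (o : X)
    th xi1 xi2 (eta : boundary X) :
  0 < th < pi / 2 -> regular_point th xi1 xi2 eta ->
  radial_limit_point G o eta ->
  exists g : nat -> self_isometry X1 * self_isometry X2,
  [/\ forall n, G (g n),
      (inl (prod_isom (g n) o) : bordification X) @[n --> \oo] -->
        (inr eta : bordification X),
      close_to_ray (fun n => (g n).1 o.1) xi1 &
      close_to_ray (fun n => (g n).2 o.2) xi2].
Proof.
move=> hth hreg [g [Gg gcvg]].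
case=> [[th' [z1 [z2 [hth' hreg' h1 h2]]]]|[z hz]|[z hz]].
- have [e1 e2] := regular_point_uniq hth hth' hreg hreg'.
  by exists g; rewrite e1 e2.
- by case: (regular_not_singular1 hth hreg hz).
- by case: (regular_not_singular2 hth hreg hz).
Qed.

End radial.

(** * Point masses of a density *)

Section finite_measure_points.
Context d (T : measurableType d) (R : realType).
Variable mu : {finite_measure set T -> \bar R}.

(** Infinitely many distinct points of equal positive mass would have infinite
    total mass. *)
Lemma equal_masses_repeat (z : nat -> T) (m : \bar R) :
  (forall n, measurable [set z n]) -> (0 < m)%E ->
  (forall n, mu [set z n] = m) -> exists i j, (i < j)%N /\ z i = z j.
Proof.
move=> mz m0 hm; apply: contrapT => hno.
have hz i j : z i = z j -> i = j.
  move=> e; apply/eqP; apply/negPn/negP; rewrite neq_ltn => /orP[] lt.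
    by apply: hno; exists i, j.
  by apply: hno; exists j, i.
have mfin : m \is a fin_num by rewrite -(hm 0%N) fin_num_measure.
have Mfin : mu setT \is a fin_num by rewrite fin_num_measure.
have m0' : 0 < fine m by rewrite fine_gt0// m0 /= ltey_eq mfin.
have hN N : fine m * N%:R <= fine (mu setT).
  rewrite -lee_fin EFinM !fineK//.
  have tr : trivIset setT (fun i => [set z i]).
    by move=> i j _ _ [y [/= -> /hz]].
  have -> : (m * N%:R%:E = mu (\big[setU/set0]_(i < N) [set z i]))%E.
    rewrite (@measure_bigsetU _ _ _ mu _ mz tr).
    rewrite (eq_bigr (fun=> m)) => [|i _]; last exact: hm.
    by rewrite -(fineK mfin) sumEFin sumr_const card_ord -EFinM mulr_natr.
  by apply: le_measure; rewrite ?inE//; exact: bigsetU_measurable.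
have := hN (Num.truncn (fine (mu setT) / fine m)).+1.
by rewrite leNgt -ltr_pdivrMl// mulrC truncnS_gt.
Qed.

Lemma integral_point (f : T -> \bar R) (x : T) : measurable [set x] ->
  (\int[mu]_(y in [set x]) f y = f x * mu [set x])%E.
Proof.
move=> mx; rewrite (@eq_integral _ _ _ mu _ (cst (f x))) ?integral_cst//.
by move=> y; rewrite inE => /= ->.
Qed.

Lemma ae_point (P : T -> Prop) (x : T) : measurable [set x] ->
  (0 < mu [set x])%E -> {ae mu, forall y, P y} -> P x.
Proof.
move=> mx m0 [N [mN N0 hN]]; apply: contrapT => hP.
have : (mu [set x] <= mu N)%E.
  by apply: le_measure; rewrite ?inE// => y ->; exact: hN.
by rewrite N0 leNgt m0.
Qed.

End finite_measure_points.

Section density.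
Context (R : realType) (X1 X2 : metricType R).
Notation X := (l2prod X1 X2).
Variables (G : set (self_isometry X1 * self_isometry X2)) (o : X) (b : R * R).
Variables (th : R) (xi0 : boundary X) (nu : X -> finite_measures xi0).
Hypotheses (cn : cn_ineq X) (hnu : is_density G o b th nu).

Definition weighted_busemann xi1 xi2 (x : X) : R :=
  b.1 * busemann xi1 o.1 x.1 + b.2 * busemann xi2 o.2 x.2.

Lemma mass_in_supp eta : (0 < nu o [set eta])%E -> supp (nu o) eta.
Proof.
move=> m0 U oU Ueta; apply: (lt_le_trans m0); apply: le_measure.
- by rewrite inE; exact: measurable_boundary1.
- by rewrite inE; apply: sub_sigma_algebra.
- by move=> y ->.
Qed.

(** The Radon-Nikodym derivative is prescribed almost everywhere, hence at every
    point of positive mass. *)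
Lemma density_point x eta xi1 xi2 : (0 < nu o [set eta])%E ->
  regular_point th xi1 xi2 eta ->
  nu x [set eta] = ((expR (weighted_busemann xi1 xi2 x))%:E * nu o [set eta])%E.
Proof.
move=> m0 hr; have meta : measurable ([set eta] : set (borel_boundary xi0)).
  exact: measurable_boundary1.
have [_ _ _ dom ae] := hnu.2 x.
have := @Radon_Nikodym_integral _ _ R (charge_of_finite_measure (nu x)) (nu o)
  [set eta] dom meta.
rewrite integral_point// => h; rewrite [LHS]h.
have /(_ (mass_in_supp m0) _ _ hr) -> := ae_point meta m0 ae.
by [].
Qed.

Lemma mass_dominated x eta : nu x [set eta] != 0%E -> (0 < nu o [set eta])%E.
Proof.
move=> h; rewrite lt_neqAle measure_ge0 andbT eq_sym.
apply: contra h => /eqP h; apply/eqP.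
have [_ _ _ dom _] := hnu.2 x.
have meta : measurable ([set eta] : set (borel_boundary xi0)).
  exact: measurable_boundary1.
have := dom [set eta]; apply => //.
by apply/measure0_null_setP.
Qed.

Lemma orbit_mass g eta : G g ->
  nu o [set boundary_act (isom_inv (prod_isom g)) eta]
  = nu (prod_isom g o) [set eta].
Proof.
move=> Gg; have [_ _ inv _ _] := hnu.2 o.
by rewrite -inv//; [rewrite boundary_act_preimage|exact: measurable_boundary1].
Qed.

(** The masses of the points of the orbit of eta are at most the total mass. *)
Lemma weighted_busemann_bounded eta xi1 xi2 : (0 < nu o [set eta])%E ->
  regular_point th xi1 xi2 eta -> exists C, forall g, G g ->
  weighted_busemann xi1 xi2 (prod_isom g o) <= C.
Proof.
move=> m0 hr; set m := nu o [set eta] in m0.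
have meta z : measurable ([set z] : set (borel_boundary xi0)).
  exact: measurable_boundary1.
have mfin : m \is a fin_num by rewrite fin_num_measure.
have Mfin : nu o setT \is a fin_num by rewrite fin_num_measure.
have m0' : 0 < fine m by rewrite fine_gt0// m0 /= ltey_eq mfin.
exists (fine (nu o setT) / fine m) => g Gg.
set w := weighted_busemann _ _ _.
have : ((expR w)%:E * m <= nu o setT)%E.
  rewrite -density_point// -orbit_mass//.
  by apply: le_measure; rewrite ?inE; [exact: meta|exact: measurableT|].
rewrite -(fineK mfin) -(fineK Mfin) -EFinM lee_fin -ler_pdivlMr//.
by apply: le_trans; have := expR_ge1Dx w; lra.
Qed.

(** The points k ^- n eta all have the mass of eta, so that two of them agree,
    say at the exponents i < j; then k ^+ (j - i) fixes eta. *)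
Lemma massive_point_fixed k eta : (0 < nu o [set eta])%E ->
  (forall n, G (k ^+ n)%g /\
     nu (prod_isom (k ^+ n)%g o) [set eta] = nu o [set eta]) ->
  exists2 n, (0 < n)%N &
    asymp (prod_isom (k ^+ n)%g \o ray_of eta) (ray_of eta).
Proof.
move=> m0 hk; pose z n := boundary_act (isom_inv (prod_isom (k ^+ n)%g)) eta.
have mz n : measurable ([set z n] : set (borel_boundary xi0)).
  exact: measurable_boundary1.
have mass n : nu o [set z n] = nu o [set eta].
  by have [Gk <-] := hk n; exact: orbit_mass.
have [i [j [ij zij]]] := equal_masses_repeat mz m0 mass.
exists (j - i)%N; first by rewrite subn_gt0.
(* k ^+ i sends z i to eta, and k ^+ j sends z j = z i to eta. *)
have hz n : asymp (prod_isom (k ^+ n)%g \o ray_of (z n)) (ray_of eta).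
  have : boundary_act (prod_isom (k ^+ n)%g) (z n) = eta.
    suff : (boundary_act (prod_isom (k ^+ n)%g) @^-1` [set eta]) (z n) by [].
    by rewrite boundary_act_preimage.
  move=> <-; apply/asymp_sym.
  exact: (@ray_of_asymp _ _ _ (isom_ray _ (ray_of (z n))) erefl).
apply: asymp_trans (hz j).
pose f := prod_isom (k ^+ (j - i))%g.
apply: asymp_trans (asymp_isom f (asymp_sym (hz i))) _.
rewrite zij; apply: eq_asymp => t _ /=.
by rewrite -prod_funM -expgnDr subnK// ltnW.
Qed.

End density.

(** * The weights of a density with a radial point mass *)

Lemma busemann_lip (R : realType) (T : metricType R) (xi : boundary T)
    (x y : T) :
  `|busemann xi x y| <= mdist x y.
Proof.
have hs := rayP (ray_of xi); rewrite busemannE ler_norml.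
have := buse_lip x y hs; have := buse_lip y x hs; rewrite (metric_sym y) => *.
by apply/andP; split; lra.
Qed.

Section weights.
Context (R : realType) (T S : metricType R).
Hypotheses (cn : cn_ineq T) (geo : geodesic_space T) (hprop : proper_space T).
Variable K : set (self_isometry T * self_isometry S).
Hypotheses (K1 : K 1%g) (KM : forall g h, K g -> K h -> K (g * h)%g)
  (KV : forall g, K g -> K (g^-1)%g).

Lemma expg_in g n : K g -> K (g ^+ n)%g.
Proof.
by move=> Kg; elim: n => [|n IH]; rewrite ?expg0// expgS; exact: KM.
Qed.

(** Along elements of K whose displacement in the second factor is o(d), d being
    their displacement in the first one, the second Busemann function is o(d),
    and left multiplication by a fixed element changes it by a constant at most.
    So the upper bound C concerns the first Busemann function alone. *)
Lemma factor_weight_ge0 g h (p : T) (q : S) xi zeta (a a' C : R) :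
  K g -> K h -> independent_rank_one g.1 h.1 ->
  (forall n, exists k, [/\ K k, n%:R <= mdist p (k.1 p) &
     mdist q (k.2 q) * n.+1%:R <= mdist p (k.1 p)]) ->
  (forall k, K k ->
     a * busemann xi p (k.1 p) + a' * busemann zeta q (k.2 q) <= C) -> 0 <= a.
Proof.
move=> Kg Kh hi /choice[k hk] hC.
pose P (f : self_isometry T) := exists k', K k' /\ k'.1 = f.
have PX f n : K f -> P (f.1 ^+ n)%g.
  by move=> Kf; exists (f ^+ n)%g; split; [exact: expg_in|exact: fst_expg].
have PV f n : K f -> P (isom_inv (f.1 ^+ n)%g).
  move=> Kf; exists (f ^+ n)^-1%g; split; first by apply: KV; exact: expg_in.
  by rewrite -fst_expg.
apply: (@slope_ge0 _ _ cn geo hprop g.1 h.1 (fun n => (k n).1 p) p (ray_of xi) P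
  (fun n => mdist q ((k n).2 q))) => //; do ?by move=> n; [exact: PX|exact: PV].
- exact: rayP.
- move=> M; exists (Num.truncn M).+1 => n Mn; apply: ltW.
  apply: (lt_le_trans (truncnS_gt M)); have [_ + _] := hk n.
  by apply: le_trans; rewrite ler_nat.
- by move=> n; apply: PX.
- by move=> n; apply: PV.
- by move=> n; apply: PX.
- by move=> n; apply: PV.
- by move=> n; rewrite mdist_ge0; have [_ _ ?] := hk n.
move=> f [k' [Kk' <-]].
exists (C - a * buse (ray_of xi) p + `|a'| * mdist q (k'.2 q)), `|a'| => n.
have [Kk _ _] := hk n.
have := hC _ (KM Kk' Kk); rewrite !mul_isomE busemannE.
set B := busemann _ _ _ => h1.
have h2 : `|B| <= mdist q (k'.2 q) + mdist q ((k n).2 q).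
  apply: (le_trans (busemann_lip _ _ _)).
  apply: (le_trans (metric_triangle _ (k'.2 q) _)).
  by rewrite isom_dist.
have h3 : - (a' * B) <= `|a'| * (mdist q (k'.2 q) + mdist q ((k n).2 q)).
  apply: (@le_trans _ _ (`|a'| * `|B|)); last by rewrite ler_wpM2l.
  by rewrite -normrM -normrN ler_norm.
by lra.
Qed.

End weights.

Theorem corollary1p9 (R : realType) (X1 X2 : metricType R)
  (hX1 : proper_hadamard_space X1) (hX2 : proper_hadamard_space X2)
  (o : l2prod X1 X2)
  (G : set (self_isometry X1 * self_isometry X2))
  (hG : group_closed (fun g => g \in G))
  (hproper : acts_properly G)
  (hrank1 : exists g h, [/\ G g, G h,
     independent_rank_one g.1 h.1 & independent_rank_one g.2 h.2])
  (hgrowth : regular_growth G o)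
  (theta : R) (htheta : 0 < theta < pi / 2)
  (b : R * R)
  (xi0 : boundary (l2prod X1 X2))
  (nu : l2prod X1 X2 -> finite_measures xi0)
  (hnu : is_density G o b theta nu) :
  forall (x : l2prod X1 X2) (eta : boundary (l2prod X1 X2)),
    radial_limit_point G o eta -> nu x [set eta] = 0%E.
Proof.
move=> x eta hrad; apply/eqP/negPn/negP => nx0.
have [[_ cat1] prop1] := hX1; have [[_ cat2] prop2] := hX2.
have cn1 := cat0_cn cat1; have cn2 := cat0_cn cat2.
have cnX := cn_l2prod cn1 cn2.
have [geo1 _] := cat1; have [geo2 _] := cat2.
have G1 : G 1%g by have := hG.1; rewrite !inE.
have GV g : G g -> G (g^-1)%g.
  by move=> /mem_set Gg; have := group_closedV hG Gg; rewrite !inE.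
have GM g h : G g -> G h -> G (g * h)%g.
  move=> /mem_set Gg /mem_set Gh.
  by have := group_closedM hG Gg Gh; rewrite !inE.
have m0 := mass_dominated cnX hnu nx0.
(* eta is in the support of nu o, hence regular of slope theta. *)
have [_ /(_ _ (mass_in_supp cnX m0))[_ [xi1 [xi2 hreg]]] _ _ _] := hnu.2 o.
have [C hC] := weighted_busemann_bounded cnX hnu m0 hreg.
have [g [h [Gg Gh hi1 hi2]]] := hrank1.
have p0 := pi_gt0 R.
have b1 : 0 <= b.1.
  apply: (@factor_weight_ge0 R X1 X2 cn1 geo1 prop1 G G1 GM GV g h o.1 o.2
    xi1 xi2 b.1 b.2 C Gg Gh hi1) => //.
  move=> n; apply: growth_horizontal; apply: hgrowth.
  by apply/andP; split; lra.
have b2 : 0 <= b.2.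
  pose K : set (self_isometry X2 * self_isometry X1) := [set k | G (k.2, k.1)].
  apply: (@factor_weight_ge0 R X2 X1 cn2 geo2 prop2 K _ _ _ (g.2, g.1)
    (h.2, h.1) o.2 o.1 xi2 xi1 b.2 b.1 C) => //.
  - by move=> k k' Kk Kk'; exact: (GM _ _ Kk Kk').
  - by move=> k Kk; exact: (GV _ Kk).
  - by rewrite /K /= -surjective_pairing.
  - by rewrite /K /= -surjective_pairing.
  - move=> n; have [|k [Gk k1 k2]] := @growth_vertical R X1 X2 G o n.
      by apply: hgrowth; apply/andP; split; lra.
    by exists (k.2, k.1); split => //; rewrite /K /= -surjective_pairing.
  - by move=> k Kk; rewrite addrC; exact: (hC _ Kk).
(* A radial sequence makes both Busemann functions tend to infinity. *)
have [b10 b20] : b.1 = 0 /\ b.2 = 0.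
  have [gn [Ggn gcvg close1 close2]] := regular_radial htheta hreg hrad.
  have [K1 hK1] := close_busemann o.1 close1.
  have [K2 hK2] := close_busemann o.2 close2.
  have bound M : 0 <= M -> (b.1 + b.2) * M <= C + b.1 * K1 + b.2 * K2.
    move=> M0; have [n [n1 n2]] := regular_cvg_diverges o htheta hreg gcvg M.
    have := hC _ (Ggn n); rewrite /weighted_busemann /=.
    have : b.1 * (M - K1) <= b.1 * busemann xi1 o.1 ((gn n).1 o.1).
      by rewrite ler_wpM2l//; apply: le_trans (hK1 n); rewrite lerD2r.
    have : b.2 * (M - K2) <= b.2 * busemann xi2 o.2 ((gn n).2 o.2).
      by rewrite ler_wpM2l//; apply: le_trans (hK2 n); rewrite lerD2r.
    by lra.
  suff : b.1 + b.2 <= 0 by split; lra.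
  rewrite leNgt; apply/negP => b0.
  pose M := (`|C + b.1 * K1 + b.2 * K2| + 1) / (b.1 + b.2).
  have M0 : 0 <= M by rewrite divr_ge0 ?addr_ge0// ltW.
  have := bound M M0; rewrite /M mulrC divfK ?gt_eqF//.
  by have := ler_norm (C + b.1 * K1 + b.2 * K2); lra.
(* All points of the orbit of eta now have the same mass. *)
have fixed k : G k -> exists2 m, (0 < m)%N &
    asymp (prod_isom (k ^+ m)%g \o ray_of eta) (ray_of eta).
  move=> Gk; apply: (massive_point_fixed cnX hnu m0) => n.
  have Gkn : G (k ^+ n)%g by apply: expg_in.
  split=> //; rewrite (density_point cnX hnu _ m0 hreg).
  by rewrite /weighted_busemann b10 b20 !mul0r addr0 expR0 mul1e.
have [m mpos hm] := fixed g Gg; have [n npos hn] := fixed h Gh.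
have [s1 [s2 [s [_ _ sE hs]]]] := hreg.
have [c0 _] := open_quadrant htheta.
have fst_fixed k i : asymp (prod_isom (k ^+ i)%g \o ray_of eta) (ray_of eta) ->
    asymp ((k.1 ^+ i)%g \o s1) s1.
  move=> ha; have hse := ray_of_asymp sE.
  have [D hD] := asymp_trans (asymp_trans (asymp_isom (prod_isom (k ^+ i)%g)
    (asymp_sym hse)) ha) hse.
  exists D => t t0; have tc : 0 <= t / cos theta by rewrite divr_ge0// ltW.
  have := hD _ tc; rewrite /= hs// divfK ?gt_eqF// /prod_fun /= fst_expg.
  exact: le_trans (l2dist_fst _ _).
exact: (independent_no_fixed cn1 geo1 prop1 hi1 (rayP s1) mpos npos
  (fst_fixed _ _ hm) (fst_fixed _ _ hn)).
Qed.
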